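(* Let $\{X_i\}_{i\ge 1}$ be a sequence of $\chi$-valued random variables in which every $X_i$ has the same marginal density $m(x)=\int_{\Theta}p(x\mid\theta)f(\theta)\,d\mu(\theta)$ with respect to $\nu$, where the support $\Theta$ of the mixing density $f$ is a finite set. Assume there are constants $c_0>0$ and $0<\rho<1$ such that for all $n\ge 1$ $$\sup_i E\Big[\int\Big(\frac{m(x_{i+n}\mid X_{1:i})}{m(x_{i+n})}-1\Big)^2 m(x_{i+n})\,d\nu(x_{i+n})\Big]\le c_0^2\rho^{2n}.$$ Assume that the initial estimate $f_0$ has the same support as $f$, and that conditions B1, B2, B3, B4, C1, C2, C3 stated in the context hold. Let $f_n$ be the predictive recursion estimator defined in the context. Then $f_n$ converges to the true mixing density $f$ with probability one as $n\to\infty$.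
   Context: Setting. $\nu$ and $\mu$ are sigma-finite measures on the sample space $\chi$ and on the parameter space. $\Theta$ is a compact (here finite) subset of a Euclidean space, $\widehat\Theta\supseteq\Theta$ is a closed convex set, and for each $\theta\in\widehat\Theta$, $p(\cdot\mid\theta)$ is a probability density on $\chi$ with respect to $\nu$ (the mixing kernel). $f$ is a density with respect to $\mu$. $X_{1:i}=\{X_1,\dots,X_i\}$, and $m(\cdot\mid X_{1:i})$ in the displayed condition is the conditional density of $X_{i+n}$ given $X_{1:i}$. Predictive recursion (PR). Starting from an initial mixing density $f_0$ and positive weights $w_i$, define for $i\ge1$ $$f_i(\theta)=(1-w_i)f_{i-1}(\theta)+w_i\frac{p(X_i\mid\theta)f_{i-1}(\theta)}{m_{i-1}(X_i)},\qquad m_{i-1}(x)=\int p(x\mid\theta)f_{i-1}(\theta)\,d\mu(\theta);$$ each iterate $f_i$ is a mixing (probability) density and $m_i$ is the corresponding marginal density. It is assumed that $K_0=\int f\log(f/f_0)\,d\mu$ and $K_0^*=\int m\log(m/m_0)\,d\nu$ are finite. Conditions. There are a finite set $\Theta_H\subset\widehat\Theta$ and a compact set $\chi_c\subset\chi$ such that: C1. For some constant $c_u>1$: for any $x\notin\chi_c$ there exist $\theta_1^x,\theta_2^x\in\Theta_H$ with $\sup_{\theta,\theta'\in\Theta}\frac{p(x\mid\theta)}{p(x\mid\theta')}\le c_u\frac{p(x\mid\theta_2^x)}{p(x\mid\theta_1^x)}$. C2. There is $a>0$ with $\inf_{x\in\chi_c,\theta\in\Theta}p(x\mid\theta)>a$.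 C3. There is $b<\infty$ with $\sup_{x\in\chi_c,\theta\in\Theta}p(x\mid\theta)<b$. B1. $w_i\downarrow0$ and $w_i\sim i^{-\alpha}$ with $\alpha\in(0.5,1]$. B2. There is $b_0>0$ (without loss of generality $b_0\ge 1$) such that for all $n_1\le n$, all distinct $j_1,\dots,j_{n_1}\in\{1,\dots,n\}$ and all $\theta_{l_1},\theta_{l_2}\in\widehat\Theta$ ($l=1,\dots,n_1$), $E\big[\big(\prod_{l=1}^{n_1}\frac{p(X_{j_l}\mid\theta_{l_1})}{p(X_{j_l}\mid\theta_{l_2})}\big)^2\big]\le b_0^{2n_1}\prod_{l=1}^{n_1}E\big[\big(\frac{p(X_{j_l}\mid\theta_{l_1})}{p(X_{j_l}\mid\theta_{l_2})}\big)^2\big]$. B3. $\sup_{\theta_1,\theta_2,\theta_3\in\widehat\Theta}E_{\theta_3}\big[\big(\frac{p(X\mid\theta_1)}{p(X\mid\theta_2)}\big)^2\big]<B<\infty$, where $E_{\theta_3}$ is expectation under $X\sim p(\cdot\mid\theta_3)$. B4. For each $x\in\chi$ the map $\theta\mapsto p(x\mid\theta)$ is bounded and continuous.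
   Formalization: Added: f is identifiable, i.e. any mixing density supported in Θ with the same mixture m (ν-a.e.) equals f μ-a.e.; without this the claim fails, e.g. for p(x|θ)=1 on [0,1]. The weights satisfy w_i ≤ 1, so that each iterate is a density. *)

(* Defs.v *)
From HB Require Import structures.
From mathcomp Require Import all_boot all_order all_algebra.
From mathcomp Require Import all_classical all_reals all_analysis.

Set Implicit Arguments.
Unset Strict Implicit.
Unset Printing Implicit Defensive.
Import Order.TTheory GRing.Theory Num.Theory.
Import numFieldNormedType.Exports.
Local Open Scope classical_set_scope.
Local Open Scope ring_scope.

Notation borel T := (g_sigma_algebraType (@open T)).

Definition is_density (R : realType) (d : measure_display)
    (T : measurableType d) (mu : {measure set T -> \bar R}) (f : T -> R) : Prop :=
  [/\ measurable_fun setT f,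
      forall t, 0 <= f t
    & (\int[mu]_t (f t)%:E = 1)%E].

(* On a null set of the carrier the value of a density is arbitrary, so the
   support is read off the given version of the density. *)
Definition dsupport (R : realType) (T : Type) (f : T -> R) : set T :=
  [set t | f t != 0].

(* The extended-real quotient has a / 0 = +oo for a > 0 and 0 / 0 = 0; hence no
   positivity of the kernel needs to be assumed in order to bound ratios. *)
Definition lratio (R : realType) (T X : Type) (p : X -> T -> R)
    (x : X) (th th' : T) : \bar R :=
  ((p x th)%:E / (p x th')%:E)%E.

Section PredictiveRecursion.
Context {R : realType} {d : measure_display} {T : measurableType d} {X : Type}.
Variables (mu : {measure set T -> \bar R}) (p : X -> T -> R).

Definition mixture (D : set T) (g : T -> R) (x : X) : R :=
  \int[mu]_(th in D) (p x th * g th).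

(* Only w i and x i with i >= 1 are used. *)
Fixpoint pred_rec (w : nat -> R) (f0 : T -> R) (x : nat -> X) (i : nat)
    : T -> R :=
  match i with
  | 0%N => f0
  | j.+1 =>
      let g := pred_rec w f0 x j in
      fun th => (1 - w j.+1) * g th
                + w j.+1 * (p (x j.+1) th * g th / mixture setT g (x j.+1))
  end.

End PredictiveRecursion.

Definition KL (R : realType) (d : measure_display) (T : measurableType d)
    (mu : {measure set T -> \bar R}) (f g : T -> R) : \bar R :=
  (\int[mu]_t (f t * ln (f t / g t))%:E)%E.

(* f is the only density supported in D, up to mu-null sets, whose mixture is
   that of f; this is what makes f recoverable from the law of the data. *)
Definition identifiable (R : realType) (d d' : measure_display)
    (T : measurableType d) (X : measurableType d')
    (mu : {measure set T -> \bar R}) (nu : {measure set X -> \bar R})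
    (p : X -> T -> R) (D : set T) (f : T -> R) : Prop :=
  forall g : T -> R, is_density mu g -> dsupport g `<=` D ->
    {ae nu, forall x, mixture mu p D g x = mixture mu p D f x} ->
    {ae mu, forall th, g th = f th}.

Section RandomVariables.
Context {R : realType} {d d' : measure_display}
        {Omega : measurableType d} {X : measurableType d'}.
Variables (P : probability Omega R) (nu : {measure set X -> \bar R}).

Definition has_density (Y : Omega -> X) (m : X -> R) : Prop :=
  forall A : set X, measurable A ->
    P (Y @^-1` A) = (\int[nu]_(x in A) (m x)%:E)%E.

(* The observations 1, ..., i: Y 0 is never used. *)
Definition history (Y : nat -> Omega -> X) (i : nat) (omega : Omega)
    : i.-tuple X :=
  [tuple Y j.+1 omega | j < i].

Definition is_cond_density (d1 : measure_display) (S : measurableType d1)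
    (H : Omega -> S) (Y : Omega -> X) (q : S -> X -> R) : Prop :=
  [/\ measurable_fun setT (fun z : S * X => q z.1 z.2),
      forall s x, 0 <= q s x
    & forall (A : set S) (B : set X), measurable A -> measurable B ->
        P (H @^-1` A `&` Y @^-1` B) =
        (\int[P]_(omega in H @^-1` A) \int[nu]_(x in B) (q (H omega) x)%:E)%E].

Definition geometric_dependence (Y : nat -> Omega -> X) (m : X -> R)
    (q : forall i : nat, nat -> i.-tuple X -> X -> R) (c0 rho : R) : Prop :=
  forall n : nat, (1 <= n)%N ->
    (ereal_sup
       [set \int[P]_omega \int[nu]_x
              (((q i n (history Y i omega) x / m x - 1) ^+ 2 * m x)%R)%:E
        | i in [set i : nat | (1 <= i)%N]]
     <= (c0 ^+ 2 * rho ^+ (2 * n))%:E)%E.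

End RandomVariables.

(* Suprema and infima are taken in \bar R, so that they are correct on empty
   sets: chic may be empty. *)

Definition ratio_dominated (R : realType) (T X : Type) (p : X -> T -> R)
    (Theta ThetaH : set T) (chic : set X) : Prop :=
  exists2 cu : R, 1 < cu &
    forall x, ~ chic x ->
      exists th1 th2, [/\ ThetaH th1, ThetaH th2 &
        (ereal_sup [set lratio p x th th' | th in Theta & th' in Theta]
         <= cu%:E * lratio p x th2 th1)%E].

Definition kernel_bounded_below (R : realType) (T X : Type) (p : X -> T -> R)
    (Theta : set T) (chic : set X) : Prop :=
  exists2 a : R, 0 < a &
    (a%:E < ereal_inf [set (p x th)%:E | x in chic & th in Theta])%E.

Definition kernel_bounded_above (R : realType) (T X : Type) (p : X -> T -> R)
    (Theta : set T) (chic : set X) : Prop :=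
  exists b : R,
    (ereal_sup [set (p x th)%:E | x in chic & th in Theta] < b%:E)%E.

(* w i <= 1 is what makes every iterate of the recursion a density; w 1 = 1 has
   to be allowed, since w i = i ^ - alpha is the standard choice. *)
Definition weights (R : realType) (w : nat -> R) : Prop :=
  [/\ forall i, (1 <= i)%N -> 0 < w i <= 1,
      forall i, (1 <= i)%N -> w i.+1 <= w i,
      w i @[i --> \oo] --> 0
    & exists2 alpha : R, 2^-1 < alpha <= 1 &
        w i / (i%:R `^ (- alpha)) @[i --> \oo] --> (1 : R)].

Definition product_moments (R : realType) (d : measure_display)
    (Omega : measurableType d) (T X : Type) (P : probability Omega R)
    (Y : nat -> Omega -> X) (p : X -> T -> R) (That : set T) : Prop :=
  exists2 b0 : R, 0 < b0 &
    forall (n n1 : nat) (j : 'I_n1 -> nat) (th1 th2 : 'I_n1 -> T),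
      (n1 <= n)%N -> injective j -> (forall l, (1 <= j l <= n)%N) ->
      (forall l, That (th1 l)) -> (forall l, That (th2 l)) ->
      (\int[P]_omega
          ((\prod_(l < n1) lratio p (Y (j l) omega) (th1 l) (th2 l)) ^+ 2)
       <= (b0 ^+ (2 * n1))%:E *
          \prod_(l < n1)
             \int[P]_omega (lratio p (Y (j l) omega) (th1 l) (th2 l) ^+ 2))%E.

Definition ratio_second_moment (R : realType) (T : Type) (d : measure_display)
    (X : measurableType d) (nu : {measure set X -> \bar R})
    (p : X -> T -> R) (That : set T) : Prop :=
  exists B : R,
    (ereal_sup [set v | exists th1 th2 th3,
        [/\ That th1, That th2, That th3 &
         v = \int[nu]_x (lratio p x th1 th2 ^+ 2 * (p x th3)%:E)]]
     < B%:E)%E.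

Definition kernel_bounded_continuous (R : realType) (T : topologicalType)
    (X : Type) (p : X -> T -> R) (That : set T) : Prop :=
  forall x, (exists M : R, forall th, That th -> `|p x th| <= M) /\
            {within That, continuous (p x)}.

(* Main.v *)
Require Import Defs.
From HB Require Import structures.
From mathcomp Require Import finmap.
From mathcomp Require Import all_boot all_order all_algebra.
From mathcomp Require Import all_classical all_reals all_analysis.
From mathcomp Require Import measurable_realfun ring lra.
Set Implicit Arguments.
Unset Strict Implicit.
Unset Printing Implicit Defensive.
Import Order.TTheory GRing.Theory Num.Theory.
Import numFieldNormedType.Exports.
Local Open Scope classical_set_scope.
Local Open Scope ring_scope.

(** Why the estimator converges.

    Both mixing densities live on the finite set [Theta], and only its points
    of positive [mu]-mass matter. Weighting by these masses turns the recursion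
    into a recursion on probability vectors indexed by a finite type, with
    target a vector [a] of positive entries ([pred_rec_cvg]). Taking the common
    law [M = m nu] of the observations as reference measure replaces the kernel
    by the ratios [s_i = p_i / m] ([mixture_rec_cvg]). The mixture density of
    the target is then the constant 1, each [s_i] is bounded by
    [L = \sum_i a_i^-1], and the moment condition on likelihood ratios says
    that [1 / s_i] is square integrable.

    In this normalization let [S_n] be the mixture density of the iterate
    [pi_n], and let [D] be the envelope [L * \sum_i s_i^-1]. The cross entropy
    [- \sum_i a_i ln (pi_n i)] is a nonnegative Lyapunov function, so along
    every trajectory
      [\sum_n w_n ((S_(n-1) X_n)^-1 - 1) <= C + 8 \sum_n w_n^2 (D X_n)^2]
    ([entropy_telescope]). If [X_n] were independent of the past, the mean of
    the summand on the left would be that of [\int (S_(n-1)^-1 - 1) dM], which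
    is at least [L^-1 \int (1 - S_(n-1))^2 dM] ([inv_mixden_lower]).

    Dependence enters through a comparison of means. The function [S_(n-1)^-1]
    is [S_0^-1] plus the increments produced by the steps [j < n]. The first
    term is deterministic and [X_n] has law [M], so replacing [X_n] by a fresh
    observation costs nothing there. The increment of step [j] at [x] is at most
    [w_j D(X_j) D(x)] ([inv_mixden_step]) and is a function of the first [j]
    observations, so there the replacement costs [O(w_j rho^(n - j))]
    ([cb_step]). The total cost [\sum_n w_n \sum_(j < n) w_j rho^(n - j)] is
    [O(\sum_j w_j^2)], which is finite because [alpha > 1/2]. Hence
    [\sum_n w_n Q(pi_(n-1))] has finite expectation and is finite almost surely,
    where [Q(g)] is the integral of [(1 - S)^2] for the mixture density [S] of
    [g]. This uses bounds on expectations only, and no martingale.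

    The rest is deterministic. A step moves at most mass [w_n], so
    [Q(pi_n)] changes by [O(w_n)]; as [\sum_n w_n] diverges, [Q(pi_n)] tends to
    zero ([excursion_cvg0]). Finally [Q] is Lipschitz on the simplex and vanishes
    only at [a], by identifiability, so compactness gives [pi_n --> a]
    ([simplex_cvg]). *)

(** * Predictive recursion over a finite index set *)

Lemma le_ln_sub1 (R : realType) (x : R) : 0 < x -> ln x <= x - 1.
Proof.
move=> x0; have := @le_ln1Dx R (x - 1).
rewrite (addrC 1) subrK; apply. lra.
Qed.

(** A second-order expansion of the logarithm that stays valid for weights up
    to [1]. For [w <= 1/2] it is the Taylor bound, since [1 + w t >= 1/2]. For
    larger [w] the quadratic term absorbs everything: [1 + w t] is still at
    least [D^-1], and [8 w ^ 2 >= 2]. *)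
Lemma neg_ln_le (R : realType) (w D t : R) :
  0 < w <= 1 -> 1 <= D -> D^-1 - 1 <= t <= D - 1 ->
  - ln (1 + w * t) <= - (w * t) + 8 * w ^+ 2 * D ^+ 2.
Proof.
move=> /andP[w0 w1] D1 /andP[tl tu].
have D0 : 0 < D by lra.
have Dinv : 0 < D^-1 by rewrite invr_gt0.
have DinvK : D^-1 * D = 1 by rewrite mulVf ?gt_eqF.
have Dinv1 : D^-1 <= 1 by rewrite invf_le1.
have y0 : D^-1 <= 1 + w * t by nra.
have y0' : 0 < 1 + w * t by lra.
case: (lerP w (2^-1)) => hw.
  have lnl : - ln (1 + w * t) <= (1 + w * t)^-1 - 1.
    by rewrite -lnV ?posrE //; apply: le_ln_sub1; rewrite invr_gt0.
  apply: (le_trans lnl).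
  have yh : 2^-1 <= 1 + w * t by nra.
  have e : (1 + w * t)^-1 - 1 = - (w * t) + (w * t) ^+ 2 / (1 + w * t).
    by field; rewrite gt_eqF.
  rewrite e lerD2l ler_pdivrMr //.
  have t2 : t ^+ 2 <= D ^+ 2 by nra.
  have : (w * t) ^+ 2 <= w ^+ 2 * D ^+ 2.
    by rewrite exprMn ler_wpM2l // sqr_ge0.
  have : 0 <= w ^+ 2 * D ^+ 2 by rewrite mulr_ge0 // sqr_ge0.
  nra.
have lnl : - ln (1 + w * t) <= D - 1.
  rewrite -lnV ?posrE //; apply: le_trans (le_ln_sub1 D0).
  rewrite ler_ln ?posrE ?invr_gt0 // -[leRHS]invrK lef_pV2 ?posrE ?invr_gt0 //.
have w2 : 4^-1 <= w ^+ 2 by nra.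
have : 4^-1 * D ^+ 2 <= w ^+ 2 * D ^+ 2 by rewrite ler_wpM2r // sqr_ge0.
nra.
Qed.

Lemma le_sum_of_ge0 (R : numDomainType) (I : finType) (F : I -> R) (i : I) :
  (forall i, 0 <= F i) -> F i <= \sum_j F j.
Proof. by move=> F0; rewrite (bigD1 i) //= lerDl sumr_ge0. Qed.

Definition distribution_on (R : realType) (I : finType) (g : I -> R) :=
  (forall i, 0 <= g i) /\ \sum_i g i = 1.

Lemma distribution_inhabited (R : realType) (I : finType) (g : I -> R) :
  \sum_i g i = 1 -> exists i : I, true.
Proof.
case: (pickP (fun _ : I => true)) => [i _|e]; first by exists i.
by rewrite big_pred0 // => /esym/eqP; rewrite oner_eq0.
Qed.

Section DiscreteRecursion.
Context {R : realType} {I : finType} {X : Type}.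
Variables (s : I -> X -> R).

Definition mixden (g : I -> R) (x : X) : R := \sum_i g i * s i x.

Definition bayes_step (g : I -> R) (v : R) (y : X) (i : I) : R :=
  (1 - v) * g i + v * (s i y * g i / mixden g y).

Fixpoint discrete_rec (w : nat -> R) (g0 : I -> R) (x : nat -> X) (n : nat)
    : I -> R :=
  match n with
  | 0%N => g0
  | j.+1 => bayes_step (discrete_rec w g0 x j) (w j.+1) (x j.+1)
  end.

Lemma discrete_rec_eq w g0 (x y : nat -> X) n :
  (forall j, (1 <= j <= n)%N -> x j = y j) ->
  discrete_rec w g0 x n = discrete_rec w g0 y n.
Proof.
elim: n => [//|n IH] h /=; rewrite IH; last first.
  by move=> j /andP[j1 jn]; apply: h; rewrite j1 ltnW.
by rewrite (h n.+1) ?leqnn.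
Qed.

Hypothesis s_gt0 : forall i x, 0 < s i x.

Let Z (x : X) := \sum_i (s i x)^-1.

Let Z_gt0 (i : I) x : 0 < Z x.
Proof.
apply: (@lt_le_trans _ _ (s i x)^-1); first by rewrite invr_gt0.
by apply: (@le_sum_of_ge0 R I (fun i => (s i x)^-1)) => j; rewrite invr_ge0 ltW.
Qed.

Let le_Z_s i x : (Z x)^-1 <= s i x.
Proof.
rewrite -[leRHS]invrK lef_pV2 ?posrE ?invr_gt0 ?(Z_gt0 i) //.
by apply: (@le_sum_of_ge0 R I (fun i => (s i x)^-1)) => j; rewrite invr_ge0 ltW.
Qed.

Let mixden_ge g x : distribution_on g -> (Z x)^-1 <= mixden g x.
Proof.
move=> [g0 g1].
rewrite -[leLHS]mul1r -g1 big_distrl; apply: ler_sum => i _.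
by rewrite ler_wpM2l // le_Z_s.
Qed.

Lemma mixden_gt0 g : distribution_on g -> forall x, 0 < mixden g x.
Proof.
move=> gP x; have [i _] := distribution_inhabited gP.2.
by apply: lt_le_trans (mixden_ge x gP); rewrite invr_gt0 (Z_gt0 i).
Qed.

Let inv_mixden_le_Z g x : distribution_on g -> (mixden g x)^-1 <= Z x.
Proof.
move=> gP; have [i _] := distribution_inhabited gP.2.
by rewrite -[leRHS]invrK lef_pV2 ?posrE ?invr_gt0 ?(Z_gt0 i) ?mixden_gt0 ?mixden_ge.
Qed.

Section OneStep.
Variables (g : I -> R) (v : R) (y : X).
Hypothesis gP : distribution_on g.
Hypothesis v01 : 0 < v <= 1.

Let bayes_stepE i :
  bayes_step g v y i = g i * (1 + v * (s i y / mixden g y - 1)).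
Proof. by rewrite /bayes_step; ring. Qed.

Let posterior_sum : \sum_i s i y * g i / mixden g y = 1.
Proof.
rewrite -mulr_suml (eq_bigr (fun i => g i * s i y)); last by move=> i _;
  rewrite mulrC.
by rewrite -/(mixden g y) divff // gt_eqF // (mixden_gt0 gP).
Qed.

Lemma bayes_step_distribution : distribution_on (bayes_step g v y).
Proof.
have [g0 g1] := gP; have /andP[v0 v1] := v01.
split=> [i|]; last first.
  by rewrite big_split/= -!mulr_sumr g1 posterior_sum; ring.
rewrite addr_ge0 // mulr_ge0 ?g0 //; first lra; first lra.
by rewrite divr_ge0 ?mulr_ge0 // ltW // (mixden_gt0 gP).
Qed.

Lemma bayes_step_gt0 : (forall i, 0 < g i) -> forall i, 0 < bayes_step g v y i.
Proof.
move=> gp i; have /andP[v0 v1] := v01; rewrite bayes_stepE mulr_gt0 //.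
have : 0 < s i y / mixden g y by rewrite divr_gt0 // (mixden_gt0 gP).
set u := _ / _; nra.
Qed.

(** The step moves mass [v] from the current distribution to the posterior, so
    it is Lipschitz in total variation whatever the observation. *)
Lemma bayes_step_l1 : \sum_i `|bayes_step g v y i - g i| <= 2 * v.
Proof.
have [g0 g1] := gP; have /andP[v0 v1] := v01.
apply: (@le_trans _ _ (\sum_i v * (s i y * g i / mixden g y + g i))).
  apply: ler_sum => i _.
  have -> : bayes_step g v y i - g i = v * (s i y * g i / mixden g y - g i).
    by rewrite /bayes_step; ring.
  rewrite normrM gtr0_norm // ler_wpM2l ?(ltW v0) // (le_trans (ler_normB _ _)) //.
  by rewrite !ger0_norm // divr_ge0 ?mulr_ge0 // ltW // (mixden_gt0 gP).
by rewrite -mulr_sumr big_split /= posterior_sum g1; lra.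
Qed.

End OneStep.

Variable a : I -> R.

Definition weight_cst : R := \sum_i (a i)^-1.

(** Uniform bound for every ratio of a component density to a mixture density,
    and for the inverse of such a ratio. *)
Definition envelope (x : X) : R := weight_cst * \sum_i (s i x)^-1.

Hypothesis a_gt0 : forall i, 0 < a i.
Hypothesis a_sum : \sum_i a i = 1.
Hypothesis as_sum : forall x, mixden a x = 1.

Let L := weight_cst.
Let D := envelope.

Lemma a_le1 i : a i <= 1.
Proof. by rewrite -a_sum; apply: le_sum_of_ge0 => j; exact: ltW. Qed.

Lemma weight_cst_ge1 : 1 <= L.
Proof.
have [i _] := distribution_inhabited a_sum.
apply: (@le_trans _ _ (a i)^-1); first by rewrite invf_ge1 ?a_le1.
by apply: (@le_sum_of_ge0 R I (fun i => (a i)^-1)) => j; rewrite invr_ge0 ltW.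
Qed.

Lemma s_le i x : s i x <= L.
Proof.
apply: (@le_trans _ _ (a i)^-1); last first.
  by apply: (@le_sum_of_ge0 R I (fun i => (a i)^-1)) => j; rewrite invr_ge0 ltW.
rewrite -[leRHS]mul1r ler_pdivlMr // mulrC -(as_sum x).
apply: (@le_sum_of_ge0 R I (fun i => a i * s i x)) => j.
by rewrite mulr_ge0 ?ltW.
Qed.

Let Z_le_envelope x : Z x <= D x.
Proof.
have [i _] := distribution_inhabited a_sum.
by rewrite ler_peMl ?weight_cst_ge1 // ltW // (Z_gt0 i).
Qed.

Lemma envelope_ge1 x : 1 <= D x.
Proof.
have [i _] := distribution_inhabited a_sum.
have h : 1 <= s i x * Z x by rewrite -ler_pdivrMr ?(Z_gt0 i) // mul1r le_Z_s.
apply: (le_trans h); apply: ler_wpM2r; [exact: ltW (Z_gt0 i x)|exact: s_le].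
Qed.

Lemma envelope_gt0 x : 0 < D x.
Proof. exact: lt_le_trans (envelope_ge1 x). Qed.

Section OneDistribution.
Variable g : I -> R.
Hypothesis gP : distribution_on g.

Lemma mixden_le x : mixden g x <= L.
Proof.
have [g0 g1] := gP.
rewrite -[leRHS]mul1r -g1 big_distrl; apply: ler_sum => i _.
by rewrite ler_wpM2l // s_le.
Qed.

Lemma inv_mixden_le x : (mixden g x)^-1 <= D x.
Proof. exact: le_trans (inv_mixden_le_Z x gP) (Z_le_envelope x). Qed.

Let likelihood_ratio_bounds i x :
  (D x)^-1 <= s i x / mixden g x <= D x.
Proof.
have := mixden_gt0 gP x => S0; apply/andP; split; last first.
  by rewrite ler_pM ?s_le ?inv_mixden_le_Z ?invr_ge0 ?ltW.
rewrite /D /envelope invfM mulrC ler_pM ?le_Z_s // ?invr_ge0.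
- exact: (ltW (Z_gt0 i x)).
- by apply: le_trans weight_cst_ge1.
- by rewrite lef_pV2 ?posrE ?mixden_le // (lt_le_trans _ weight_cst_ge1).
Qed.

(** Comes from [S^-1 = 2 - S + (1 - S) ^ 2 / S] and [S <= L]: the excess of the
    mean of [S^-1] over [1] controls the squared distance of [S] from [1]. *)
Lemma inv_mixden_lower x :
  2 - mixden g x + L^-1 * (1 - mixden g x) ^+ 2 <= (mixden g x)^-1.
Proof.
have S0 := mixden_gt0 gP x; have SL := mixden_le x.
set S := mixden g x in S0 SL *.
have -> : S^-1 = 2 - S + S^-1 * (1 - S) ^+ 2 by field; rewrite gt_eqF.
rewrite lerD2l ler_wpM2r ?sqr_ge0 //.
by rewrite lef_pV2 ?posrE // (lt_le_trans S0).
Qed.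

Variables (v : R) (y : X).
Hypothesis v01 : 0 < v <= 1.

(** One step changes the density at [x] by a factor [1 + O(v D y)], and the
    inverse densities are at most [D x]. *)
Lemma inv_mixden_step x :
  `|(mixden (bayes_step g v y) x)^-1 - (mixden g x)^-1| <= v * (D y * D x).
Proof.
have [g0 g1] := gP; have /andP[v0 v1] := v01.
have S0 := mixden_gt0 gP x.
have D0 := envelope_gt0 y.
have uD := bayes_step_distribution y gP v01.
have dS : `|mixden (bayes_step g v y) x - mixden g x| <= v * D y * mixden g x.
  rewrite /mixden -sumrB mulr_sumr; apply: (le_trans (ler_norm_sum _ _ _)).
  apply: ler_sum => i _.
  have -> : bayes_step g v y i * s i x - g i * s i x
     = v * (s i y / mixden g y - 1) * (g i * s i x) by rewrite /bayes_step; ring.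
  have gs0 : 0 <= g i * s i x by rewrite mulr_ge0 // ltW.
  rewrite !normrM (ger0_norm (g0 i)) (gtr0_norm (s_gt0 i x)) (gtr0_norm v0).
  rewrite ler_wpM2r // ler_wpM2l ?(ltW v0) //.
  have /andP[l u] := likelihood_ratio_bounds i y.
  have : 0 < (D y)^-1 by rewrite invr_gt0.
  have := envelope_ge1 y.
  rewrite ler_norml => h1 h2; apply/andP; split; lra.
have S'0 := mixden_gt0 uD x.
have -> : (mixden (bayes_step g v y) x)^-1 - (mixden g x)^-1 =
    (mixden g x - mixden (bayes_step g v y) x) /
    (mixden (bayes_step g v y) x * mixden g x).
  by field; rewrite !gt_eqF.
rewrite normrM distrC normfV (gtr0_norm (mulr_gt0 S'0 S0)).
rewrite ler_pdivrMr; last exact: mulr_gt0.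
apply: (le_trans dS).
have i1 : 1 <= D x * mixden (bayes_step g v y) x.
  have [i _] := distribution_inhabited a_sum.
  have := mixden_ge x uD.
  rewrite -[(Z x)^-1]mul1r ler_pdivrMr ?(Z_gt0 i) // mulrC => h;
    apply: (le_trans h).
  by rewrite ler_wpM2r ?Z_le_envelope // ltW.
have : 0 <= v * D y * mixden g x.
  by apply: mulr_ge0; [apply: mulr_ge0|]; exact: ltW.
have -> : v * (D y * D x) * (mixden (bayes_step g v y) x * mixden g x) =
  (v * D y * mixden g x) * (D x * mixden (bayes_step g v y) x) by ring.
by move=> h; rewrite ler_peMr.
Qed.

(** Averaging [neg_ln_le] against [a] turns the first-order term into
    [(mixden g y)^-1 - 1], because [\sum_i a i * s i y = 1]. *)
Lemma entropy_step : (forall i, 0 < g i) ->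
  - (\sum_i a i * ln (bayes_step g v y i)) <=
  - (\sum_i a i * ln (g i)) - v * ((mixden g y)^-1 - 1)
    + 8 * v ^+ 2 * D y ^+ 2.
Proof.
move=> gp; have /andP[v0 v1] := v01.
have bE i : bayes_step g v y i = g i * (1 + v * (s i y / mixden g y - 1)).
  by rewrite /bayes_step; ring.
have step i : - (a i * ln (bayes_step g v y i)) <= - (a i * ln (g i)) +
   a i * (- (v * (s i y / mixden g y - 1)) + 8 * v ^+ 2 * D y ^+ 2).
  rewrite bE lnM ?posrE //; last first.
    by have := bayes_step_gt0 y gP v01 gp i; rewrite bE pmulr_rgt0.
  rewrite mulrDr opprD lerD2l -mulrN ler_wpM2l ?(ltW (a_gt0 i)) //.
  apply: neg_ln_le => //; first exact: envelope_ge1.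
  by rewrite !lerD2r likelihood_ratio_bounds.
rewrite -!sumrN; apply: le_trans (ler_sum _ (fun i _ => step i)) _.
rewrite big_split /= -addrA lerD2l.
have -> : \sum_i a i * (- (v * (s i y / mixden g y - 1)) + 8 * v ^+ 2 * D y ^+ 2)
  = - v * (mixden g y)^-1 * mixden a y + (v + 8 * v ^+ 2 * D y ^+ 2) * \sum_i a i.
  by rewrite !mulr_sumr -big_split /=; apply: eq_bigr => i _; ring.
by rewrite as_sum a_sum; lra.
Qed.

End OneDistribution.

Variables (w : nat -> R) (g0 : I -> R).
Hypothesis w01 : forall n, (1 <= n)%N -> 0 < w n <= 1.
Hypothesis g0_gt0 : forall i, 0 < g0 i.
Hypothesis g0_sum : \sum_i g0 i = 1.

Let discrete_rec_gt0_dist x n :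
  (forall i, 0 < discrete_rec w g0 x n i) /\ distribution_on (discrete_rec w g0 x n).
Proof.
elim: n => [|n [IHp IHd]] /=; first by split => //; split => // i; exact: ltW.
split; first exact: bayes_step_gt0 (w01 _) IHp.
exact: bayes_step_distribution (w01 _).
Qed.

Lemma discrete_rec_dist x n : distribution_on (discrete_rec w g0 x n).
Proof. by case: (discrete_rec_gt0_dist x n). Qed.

(** The cross entropy [- \sum_i a i * ln (g i)] is a Lyapunov function: it is
    nonnegative on distributions, hence the decrements collected along any
    trajectory are bounded by its initial value and the quadratic errors. *)
Lemma entropy_telescope x N :
  \sum_(n < N) w n.+1 * (mixden (discrete_rec w g0 x n) (x n.+1))^-1 <=
  - (\sum_i a i * ln (g0 i))
  + \sum_(n < N) w n.+1 + 8 * \sum_(n < N) w n.+1 ^+ 2 * D (x n.+1) ^+ 2.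
Proof.
suff H : - (\sum_i a i * ln (discrete_rec w g0 x N i)) +
    \sum_(n < N) w n.+1 * (mixden (discrete_rec w g0 x n) (x n.+1))^-1 <=
  - (\sum_i a i * ln (g0 i))
  + \sum_(n < N) w n.+1 + 8 * \sum_(n < N) w n.+1 ^+ 2 * D (x n.+1) ^+ 2.
  apply: le_trans H; rewrite lerDr oppr_ge0; apply: sumr_le0 => i _.
  rewrite mulr_ge0_le0 ?(ltW (a_gt0 i)) // ln_le0 //.
  have [p0 p1] := discrete_rec_dist x N.
  by rewrite -p1; exact: le_sum_of_ge0.
elim: N => [|N IH]; first by rewrite !big_ord0 mulr0 !addr0.
rewrite !big_ord_recr /=.
have [dp dd] := discrete_rec_gt0_dist x N.
have := entropy_step dd (x N.+1) (w01 (ltn0Sn N)) dp.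
rewrite -/D; lra.
Qed.

End DiscreteRecursion.

(** * Deterministic convergence arguments *)

(** If [a n > 2 e] far out, then [a] can never descend below [e] again: the
    descent would use weight at least [e / L], hence contribute [e ^ 2 / L] to
    a tail of the convergent series of the [w n * a n]. But staying above [e]
    for ever contradicts the divergence of the weights. *)
Lemma excursion_cvg0 (R : realType) (w a : nat -> R) (L C : R) :
  (forall n, 0 <= w n) -> (forall n, 0 <= a n) -> 0 < L ->
  (forall M, exists N, M < \sum_(n < N) w n) ->
  (forall N, \sum_(n < N) w n * a n <= C) ->
  (forall n, `|a n.+1 - a n| <= L * w n) ->
  a n @[n --> \oo] --> (0 : R).
Proof.
move=> w0 a0 L0 wdiv waC astep.
have cv : cvgn (series (fun n => w n * a n)).
  apply: nondecreasing_is_cvgn.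
    by apply: nondecreasing_series => n _ _; rewrite mulr_ge0.
  by exists C => _ [N _ <-]; rewrite seriesEord; exact: waC.
apply/cvgrPdist_lt => e e0.
pose e' := e / 4; have e'0 : 0 < e' by rewrite divr_gt0.
move: cv => /cauchy_cvgP/cauchy_seriesP/(_ (e' ^+ 2 / L)).
have eL0 : 0 < e' ^+ 2 / L by rewrite divr_gt0 // exprn_gt0.
move=> /(_ eL0); case.
move=> [U V] /= [[N1 _ UN] [N2 _ VN]] UV.
pose N := maxn N1 N2.
have tail n m : (N <= n)%N -> \sum_(n <= k < m) w k * a k < e' ^+ 2 / L.
  move=> Nn; case: (leqP n m) => nm; last first.
    by rewrite big_geq ?(ltnW nm) // divr_gt0 // exprn_gt0.
  apply: le_lt_trans (ler_norm _) _; apply: (UV (n, m)); split => /=.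
    by apply: UN; rewrite /= (leq_trans _ Nn) // leq_maxl.
  by apply: VN; rewrite /= (leq_trans _ nm) // (leq_trans _ Nn) // leq_maxr.
near=> n.
have Nn : (N <= n)%N by near: n; exists N.
rewrite sub0r normrN ger0_norm //.
suff : a n <= 2 * e' by rewrite /e'; lra.
rewrite leNgt; apply/negP => an.
have H m : (n <= m)%N -> (forall k, (n <= k <= m)%N -> e' <= a k) /\
    e' * \sum_(n <= k < m) w k <= \sum_(n <= k < m) w k * a k.
  have bound m' : (forall k, (n <= k <= m')%N -> e' <= a k) ->
     e' * \sum_(n <= k < m'.+1) w k <= \sum_(n <= k < m'.+1) w k * a k.
    move=> h; rewrite mulr_sumr big_nat_cond [leRHS]big_nat_cond;
      apply: ler_sum => k.
    by rewrite andbT ltnS => /h ak; rewrite mulrC ler_wpM2l.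
  have dist m' : (n <= m')%N -> a n - L * \sum_(n <= k < m') w k <= a m'.
    move=> /subnKC <-; elim: (m' - n)%N => [|j IH].
      by rewrite addn0 big_geq // mulr0 subr0.
    rewrite addnS big_nat_recr ?leq_addr //=.
    have := astep (n + j)%N; rewrite ler_norml => /andP[+ _]; lra.
  elim: m => [|m IH]; rewrite ?leqn0 => nm.
    split; last by rewrite (eqP nm) !big_geq ?mulr0.
    by move=> k; rewrite (eqP nm) leqn0 => /eqP ->; rewrite -(eqP nm); lra.
  move: nm; rewrite leq_eqVlt => /orP[/eqP nm|].
    split; last by rewrite nm !big_geq ?mulr0.
    by move=> k; rewrite -nm => /anti_leq <-; lra.
  rewrite ltnS => nm; have [h _] := IH nm.
  have hb := bound m h.
  split => // k /andP[nk]; rewrite leq_eqVlt => /orP[/eqP ->|]; last first.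
    by rewrite ltnS => km; apply: h; rewrite nk km.
  have d := dist m.+1 (leqW nm).
  have t := tail n m.+1 Nn.
  have : e' * \sum_(n <= k0 < m.+1) w k0 < e' * (e' / L).
    by apply: le_lt_trans hb _; rewrite mulrA -expr2.
  rewrite ltr_pM2l // ltr_pdivlMr // mulrC; lra.
have [M HM] := wdiv (\sum_(k < n) w k + e' / L).
have nM : (n <= M)%N.
  rewrite leqNgt; apply/negP => Mn; move: HM; apply/negP; rewrite -leNgt.
  rewrite -(big_mkord predT w) -(big_mkord predT w) (big_cat_nat (n :=
    M) (leq0n _) (ltnW Mn)) //=.
  rewrite -addrA lerDl addr_ge0 ?sumr_ge0 // divr_ge0 ?ltW //.
have [_ hb] := H M nM.
have t := tail n M Nn.
have : e' * \sum_(n <= k < M) w k < e' * (e' / L).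
  by apply: le_lt_trans hb _; rewrite mulrA -expr2.
rewrite ltr_pM2l // => ub.
move: HM;
  rewrite -(big_mkord predT w) -(big_mkord predT w) (big_cat_nat (n :=
    n) (leq0n _) nM) //=.
rewrite ltrD2l; lra.
Unshelve. all: by end_near.
Qed.

(** Telescoping: [n.+2 ^ (- 1 - b) <= b^-1 (n.+1 ^ (- b) - n.+2 ^ (- b))]. *)
Lemma sum_powRN_bounded (R : realType) (b : R) : 0 < b ->
  forall N, \sum_(n < N) n.+1%:R `^ (- (1 + b)) <= 1 + b^-1.
Proof.
move=> b0 N.
suff H : \sum_(n < N) n.+1%:R `^ (- (1 + b)) <= 1 + b^-1 * (1 - N%:R `^ (- b)) \/ N = 0%N.
  case: H => [h|->]; last by rewrite big_ord0 addr_ge0 // invr_ge0 ltW.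
  apply: (le_trans h); rewrite lerD2l; apply: ler_piMr.
    by rewrite invr_ge0 ltW.
  by have := powR_ge0 (N%:R : R) (- b); lra.
elim: N => [|N IH]; first by right.
left; rewrite big_ord_recr /=; case: IH => [IH|->]; last first.
  by rewrite big_ord0 !powR1 subrr mulr0 add0r addr0.
case: N IH => [|N] IH; first by rewrite big_ord0 !powR1 subrr mulr0 add0r addr0.
suff : N.+2%:R `^ (- (1 + b)) <= b^-1 * (N.+1%:R `^ (- b) - N.+2%:R `^ (- b))
  by lra.
have n1 : (0 : R) < N.+1%:R by rewrite ltr0n.
have n2 : (0 : R) < N.+2%:R by rewrite ltr0n.
rewrite mulrC ler_pdivlMr //.
have -> : N.+2%:R `^ (- (1 + b)) = N.+2%:R `^ (- b) * N.+2%:R^-1 :> R.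
  rewrite -(powR_inv1 (ltW n2)) -powRD; first by rewrite opprD addrC.
  by rewrite (gt_eqF n2) implybT.
have -> : N.+1%:R `^ (- b) = N.+2%:R `^ (- b) * (N.+1%:R / N.+2%:R) `^ (- b) :> R.
  by rewrite -powRM ?divr_ge0 ?ler0n // mulrC divfK ?gt_eqF.
rewrite -mulrA -[X in _ <= _ - X]mulr1 -mulrBr ler_wpM2l ?powR_ge0 //.
have q0 : 0 < N.+1%:R / N.+2%:R :> R by rewrite divr_gt0.
rewrite /powR gt_eqF //.
have := @expR_ge1Dx R (- b * ln (N.+1%:R / N.+2%:R)).
have := ler_wpM2l (ltW b0) (le_ln_sub1 q0).
have -> : N.+1%:R / N.+2%:R = 1 - N.+2%:R^-1 :> R.
  by rewrite -[N.+2%:R]natr1 in n2 *; field; rewrite gt_eqF.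
rewrite mulNr; set E := expR _; set l := ln _; set u := N.+2%:R^-1.
move: E l u => E l u; lra.
Qed.

Section Weights.
Variables (R : realType) (w : nat -> R).
Hypothesis wP : weights w.

Lemma weights_comparable : exists2 alpha : R, 2^-1 < alpha <= 1 &
  exists2 c : R, 0 < c & forall n,
    w n.+1 <= c * n.+1%:R `^ (- alpha) /\ n.+1%:R `^ (- alpha) <= c * w n.+1.
Proof.
have [w01 _ _ [alpha al cvw]] := wP.
exists alpha => //.
have p0 n : (0 : R) < n.+1%:R `^ (- alpha) by rewrite powR_gt0 // ltr0n.
have w0 n : 0 < w n.+1 by have /andP[] := w01 n.+1 isT.
have cv1 : w n.+1 / (n.+1%:R `^ (- alpha)) @[n --> \oo] --> (1 : R).
  by move: cvw; rewrite -(cvg_shiftS (fun i => w i / (i%:R `^ (- alpha)))).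
have cv2 : (w n.+1 / (n.+1%:R `^ (- alpha)))^-1 @[n --> \oo] --> (1 : R).
  by rewrite -[X in _ --> X]invr1; exact: cvgV (oner_neq0 R) cv1.
have [c1 c1P] := cvg_has_ub (cvgP _ cv1).
have [c2 c2P] := cvg_has_ub (cvgP _ cv2).
exists (Num.max 1 (Num.max c1 c2)); first by rewrite lt_max ltr01.
move=> n; split.
  rewrite -ler_pdivrMr // le_max; apply/orP; right; rewrite le_max; apply/orP; left.
  by apply: c1P; exists n => //; rewrite ger0_norm // divr_ge0 // ltW.
rewrite -ler_pdivrMr // le_max; apply/orP; right; rewrite le_max; apply/orP; right.
apply: c2P; exists n => //; rewrite invf_div ger0_norm // divr_ge0 // ltW //.
Qed.

Lemma weights_sq_bounded : exists C : R, forall N, \sum_(n < N) w n.+1 ^+ 2 <= C.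
Proof.
have [w01 _ _ _] := wP.
have [alpha /andP[al _] [c c0 cP]] := weights_comparable.
have b0 : 0 < 2 * alpha - 1 by lra.
exists (c ^+ 2 * (1 + (2 * alpha - 1)^-1)) => N.
apply: (@le_trans _ _ (\sum_(n < N) c ^+ 2 * n.+1%:R `^ (- (1 + (2 * alpha - 1))))).
  apply: ler_sum => n _; have [h _] := cP n.
  have /andP[wn _] := w01 n.+1 isT.
  have -> : - (1 + (2 * alpha - 1)) = - alpha * 2%:R by ring.
  rewrite powRrM powR_mulrn ?powR_ge0 // -exprMn lerXn2r ?nnegrE ?(ltW wn) //.
  by rewrite mulr_ge0 ?powR_ge0 // ltW.
rewrite -mulr_sumr ler_wpM2l ?sqr_ge0 //; exact: sum_powRN_bounded.
Qed.

Lemma weights_sum_unbounded : forall M : R, exists N, M < \sum_(n < N) w n.+1.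
Proof.
have [w01 _ _ _] := wP.
have [alpha /andP[al al1] [c c0 cP]] := weights_comparable.
move=> M; apply: contrapT => /forallNP h.
apply: (@dvg_riemannR R alpha); first by rewrite al1 andbT; lra.
apply: nondecreasing_is_cvgn.
  by apply: nondecreasing_series => n _ _; apply/ltW/riemannR_gt0; lra.
exists (c * M) => _ [N _ <-]; rewrite seriesEord /=.
apply: (@le_trans _ _ (\sum_(n < N) c * w n.+1)).
  by apply: ler_sum => n _; rewrite /riemannR -powRN; case: (cP n).
by rewrite -mulr_sumr ler_wpM2l ?(ltW c0) // leNgt; apply/negP.
Qed.

(** [\sum_(1 <= j <= n) w j * rho ^ (n.+1 - j)]: the accumulated influence of
    the first [n] steps on the observation [n.+1]. *)
Fixpoint discounted (rho : R) n : R :=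
  match n with 0%N => 0 | m.+1 => rho * (discounted rho m + w m.+1) end.

Lemma discounted_ge0 rho n : 0 <= rho -> 0 <= discounted rho n.
Proof.
move=> r0; have [w01 _ _ _] := wP.
elim: n => //= n IH; rewrite mulr_ge0 // addr_ge0 //.
by have /andP[/ltW] := w01 n.+1 isT.
Qed.

(** Since the weights decrease, [w n.+2 * discounted n.+1] is at most
    [rho * (w n.+1 * discounted n + w n.+1 ^ 2)], and this recursion sums up. *)
Lemma discounted_sum rho N : 0 < rho < 1 ->
  (1 - rho) * \sum_(n < N) w n.+1 * discounted rho n <= \sum_(n < N) w n.+1 ^+ 2.
Proof.
move=> /andP[r0 r1]; have [w01 wd _ _] := wP.
(* The extra boundary term makes the induction go through. *)
suff : (1 - rho) * (\sum_(n < N) w n.+1 * discounted rho n) + w N.+1 * discounted rho N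
   <= \sum_(n < N) w n.+1 ^+ 2.
  apply: le_trans; rewrite lerDl mulr_ge0 ?discounted_ge0 ?(ltW r0) //.
  by have /andP[/ltW] := w01 N.+1 isT.
elim: N => [|N IH]; first by rewrite !big_ord0 /= !mulr0 addr0.
rewrite !big_ord_recr /=.
have d0 := discounted_ge0 N (ltW r0).
have /andP[w0 _] := w01 N.+1 isT.
have := wd N.+1 isT => wl.
have : w N.+2 * (rho * (discounted rho N + w N.+1)) <=
       w N.+1 * (rho * (discounted rho N + w N.+1)).
  by rewrite ler_wpM2r // mulr_ge0 ?(ltW r0) // addr_ge0 // ltW.
have : 0 <= (1 - rho) * w N.+1 ^+ 2 by rewrite mulr_ge0 ?sqr_ge0 //; lra.
move: IH; set A := \sum_(n < N) _; set B := \sum_(n < N) _; nra.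
Qed.

End Weights.

(** A cluster point of [g] has [Q <= 0] by the one-sided Lipschitz bound, hence
    is [a]; a sequence in a compact set with a single cluster point converges.
    The simplex is carried to row vectors, where boxes are compact. *)
Lemma simplex_cvg (R : realType) (I : finType) (Q : (I -> R) -> R) (a : I -> R)
    (g : nat -> I -> R) (C : R) :
  (forall h h', distribution_on h -> distribution_on h' ->
     Q h <= Q h' + C * \sum_i `|h i - h' i|) ->
  (forall h, distribution_on h -> Q h <= 0 -> h = a) ->
  (forall n, distribution_on (g n)) ->
  Q (g n) @[n --> \oo] --> (0 : R) ->
  forall i, g n i @[n --> \oo] --> a i.
Proof.
move=> Qlip Qa gd Qg i.
pose vec (h : I -> R) : 'rV[R]_#|I| := \row_j h (enum_val j).
pose fn (v : 'rV[R]_#|I|) : I -> R := fun k => v ord0 (enum_rank k).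
have fnK h : fn (vec h) = h.
  by apply/funext => k; rewrite /fn /vec mxE enum_rankK.
have vecK v : vec (fn v) = v.
  by apply/rowP => j; rewrite /fn /vec mxE enum_valK.
have ballE p e v : ball p e v -> forall k : I,
    `|fn p k - fn v k| < e.
  by move=> [_ h] k; exact: h.
(* Larger than [0, 1], so that the box is a neighbourhood of the limit. *)
pose V := [set v : 'rV[R]_#|I| | forall j, `[-1, 2]%classic (v ord0 j)].
have cV : compact V.
  by apply: (@rV_compact R _ (fun=> `[-1, 2]%classic)) => _; exact: segment_compact.
have le1 (h : I -> R) : distribution_on h -> forall k, 0 <= h k <= 1.
  move=> [h0 h1] k; rewrite h0 /= -h1 (bigD1 k) //= lerDl sumr_ge0 //.
have inV (h : I -> R) : distribution_on h -> V (vec h).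
  move=> hd j; rewrite /= mxE in_itv /=.
  by have /andP[? ?] := le1 h hd (enum_val j); apply/andP; split; lra.
pose G : set_system 'rV[R]_#|I| := (vec \o g) n @[n --> \oo].
have FV : G V by exists 0%N => // n _ /=; exact: inV.
have clos_d p : cluster G p -> distribution_on (fn p).
  move=> clp.
  have near_p e : 0 < e -> exists n, forall k, `|fn p k - g n k| < e.
    move=> e0.
    have Gr : G (range (vec \o g)) by exists 0%N => // n _ /=; exists n.
    have [_ [[n _ <-] bn]] := clp _ _ Gr (nbhsx_ballx p e e0).
    exists n => k; have := ballE _ _ _ bn k; by rewrite /= fnK.
  split=> [k|].
    rewrite leNgt; apply/negP => pk.
    have [|n /(_ k)] := near_p (- fn p k); first lra.
    have [g0 _] := gd n; have := g0 k.
    by rewrite ltr_norml => h /andP[]; lra.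
  apply/eqP; rewrite -subr_eq0 -normr_eq0 eq_le normr_ge0 andbT.
  apply/ler_addgt0Pr => e e0; rewrite add0r.
  have K0 : 0 < #|I|.+1%:R :> R by rewrite ltr0n.
  have [|n hn] := near_p (e / #|I|.+1%:R); first by rewrite divr_gt0.
  have [_ <-] := gd n; rewrite -sumrB (le_trans (ler_norm_sum _ _ _)) //.
  apply: (@le_trans _ _ (\sum_(k : I) e / #|I|.+1%:R)).
    by apply: ler_sum => k _; exact/ltW/hn.
  rewrite sumr_const -[leLHS]mulr_natr -mulrA ler_piMr ?(ltW e0) //.
  by rewrite mulrC ler_pdivrMr // mul1r ler_nat.
have cl1 p : cluster G p -> p = vec a.
  move=> clp; have pd := clos_d p clp.
  rewrite -(Qa _ pd) ?vecK //.
  apply/ler_addgt0Pr => e e0; rewrite add0r.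
  have e20 : 0 < e / 2 by rewrite divr_gt0.
  have GQ : G [set vec (g n) | n in [set n | `|Q (g n)| < e / 2]].
    have /cvgrPdist_lt/(_ _ e20) := Qg; apply: filterS => n /=.
    by rewrite sub0r normrN => h; exists n.
  pose K := (`|C| + 1) * #|I|.+1%:R.
  have K0 : 0 < K by rewrite mulr_gt0 ?ltr0n // ltr_wpDl.
  have [_ [[n Qn <-] bn]] :=
    clp _ _ GQ (nbhsx_ballx p (e / 2 / K) (divr_gt0 e20 K0)).
  apply: le_trans (Qlip _ _ pd (gd n)) _.
  have S1 : \sum_i0 `|fn p i0 - g n i0| <= #|I|.+1%:R * (e / 2 / K).
    apply: (@le_trans _ _ (\sum_(k : I) (e / 2 / K))).
      apply: ler_sum => k _; have := ballE _ _ _ bn k.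
      by rewrite fnK => /ltW.
    rewrite sumr_const -[leLHS]mulr_natl ler_wpM2r // ?ler_nat //.
    by rewrite divr_ge0 // ltW.
  have S0 : 0 <= \sum_i0 `|fn p i0 - g n i0| by exact: sumr_ge0.
  have : C * \sum_i0 `|fn p i0 - g n i0| <= e / 2.
    apply: (@le_trans _ _ ((`|C| + 1) * \sum_i0 `|fn p i0 - g n i0|)).
      by rewrite ler_wpM2r // (le_trans (ler_norm C)) // lerDl.
    apply: (@le_trans _ _ ((`|C| + 1) * (#|I|.+1%:R * (e / 2 / K)))).
      by rewrite ler_wpM2l // addr_ge0.
    have -> : (`|C| + 1) * (#|I|.+1%:R * (e / 2 / K)) = K * (e / 2 / K)
      by exact: mulrA.
    by rewrite [K * _]mulrC divfK ?gt_eqF.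
  move: Qn => /= Qn; have := ler_norm (Q (g n)); lra.
have PG : ProperFilter G by exact: fmap_proper_filter.
have [q [_ clq]] := cV G PG FV.
have qa := cl1 q clq.
have ad : distribution_on a by rewrite -(fnK a) -qa; exact: clos_d.
have cva : G --> vec a.
  apply: (@compact_cluster_set1 _ (vec a) G V _ cV) => //.
  - apply/nbhs_ballP; exists 1 => //= v bv j.
    have := ballE _ _ _ bv (enum_val j).
    rewrite fnK /fn enum_valK /= in_itv /=.
    have /andP[a0 a1] := le1 a ad (enum_val j).
    by rewrite ltr_norml => /andP[? ?]; apply/andP; split; lra.
  - by apply/seteqP; split => [p /cl1 //|p ->]; rewrite -qa.
have := cvg_comp _ _ cva (@coord_continuous R 1 #|I| ord0 (enum_rank i) (vec a)).
rewrite /vec mxE enum_rankK.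
by apply: cvg_trans; apply: near_eq_cvg; near=> n; rewrite /= mxE enum_rankK.
Unshelve. all: by end_near.
Qed.

(** * Densities and conditional densities *)

Lemma measurable_fun_inv (R : realType) (d : measure_display) (T : measurableType d)
    (f : T -> R) :
  measurable_fun setT f -> (forall x, 0 <= f x) ->
  measurable_fun setT (fun x => (f x)^-1).
Proof.
move=> mf f0; rewrite (_ : (fun x => _) = (@powR R)^~ (-1) \o f); last first.
  by apply/funext => x /=; rewrite powR_inv1.
by apply: measurableT_comp => //; exact: measurable_powR.
Qed.

Section Density.
Local Open Scope ereal_scope.
Context (R : realType) (d : measure_display) (T : measurableType d).
Variables (mu : {measure set T -> \bar R}) (h : T -> R).
Hypothesis mh : measurable_fun setT h.
Hypothesis h0 : forall x, (0 <= h x)%R.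

Definition mdensity (A : set T) : \bar R := \int[mu]_(x in A) (h x)%:E.

Let mdensity0 : mdensity set0 = 0.
Proof. by rewrite /mdensity integral_set0. Qed.

Let mdensity_ge0 A : 0 <= mdensity A.
Proof. by apply: integral_ge0 => x _; rewrite lee_fin. Qed.

Let mEh : measurable_fun setT (EFin \o h).
Proof. exact/measurable_EFinP. Qed.

Let mdensity_sigma_additive : semi_sigma_additive mdensity.
Proof.
move=> F mF tF mUF; rewrite /mdensity ge0_integral_bigcup //; last 2 first.
- exact: measurable_funS mEh.
- by move=> x _; rewrite lee_fin.
by apply: is_cvg_ereal_nneg_natsum_cond => n _ _; exact: mdensity_ge0.
Qed.

HB.instance Definition _ := isMeasure.Build _ _ _
  mdensity mdensity0 mdensity_ge0 mdensity_sigma_additive.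

Variable m2 : {measure set T -> \bar R}.
Hypothesis m2E : forall A, measurable A -> m2 A = \int[mu]_(x in A) (h x)%:E.

Import HBNNSimple.

Lemma ge0_integral_density (f : T -> \bar R) :
  measurable_fun setT f -> (forall x, 0 <= f x) ->
  \int[m2]_x f x = \int[mu]_x (f x * (h x)%:E).
Proof.
move=> mf f0; pose g := nnsfun_approx measurableT mf.
have cvg_f x : EFin \o g ^~ x @ \oo --> f x by exact: cvg_nnsfun_approx.
have -> : \int[m2]_x f x = limn (fun n => \int[m2]_x (g n x)%:E).
  rewrite -monotone_convergence //.
  - by apply: eq_integral => x _; apply/esym/cvg_lim => //; exact: cvg_f.
  - by move=> n; exact/measurable_EFinP.
  - by move=> n x _; rewrite lee_fin.
  - by move=> x _ a b ab; rewrite lee_fin; exact/lefP/nd_nnsfun_approx.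
have -> : \int[mu]_x (f x * (h x)%:E) = limn (fun n =>
  \int[mu]_x ((g n x)%:E * (h x)%:E)).
  rewrite -monotone_convergence //.
  - apply: eq_integral => x _; apply/esym/cvg_lim => //.
    by apply: cvgeZr => //; exact: cvg_f.
  - by move=> n; apply: emeasurable_funM => //; exact/measurable_EFinP.
  - by move=> n x _; rewrite mule_ge0 ?lee_fin.
  - by move=> x _ a b ab; rewrite lee_wpmul2r ?lee_fin //;
      exact/lefP/nd_nnsfun_approx.
congr (limn _); apply/funext => n.
have mindic r : measurable_fun setT (fun x =>
  (r * \1_(g n @^-1` [set r]) x)%:E : \bar R).
  by apply/measurable_EFinP; exact: measurable_funM.
transitivity (\int[m2]_x
   (\sum_(y \in range (g n)) (y * \1_(g n @^-1` [set y]) x)%:E)).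
  by apply: eq_integral => t tE; rewrite fsumEFin // -fimfunE.
rewrite ge0_integral_fsum//; last by move=> m y Ey; exact: nnfun_muleindic_ge0.
transitivity (\int[mu]_x (\sum_(y \in range (g n))
    (y * \1_(g n @^-1` [set y]) x)%:E * (h x)%:E)); last first.
  under eq_integral => x xE.
    rewrite -ge0_mule_fsuml => [|y]; last exact: nnfun_muleindic_ge0.
    rewrite fsumEFin // -(fimfunE _ x); over.
  by [].
rewrite ge0_integral_fsum//; last 2 first.
  - by move=> y; exact: emeasurable_funM.
  - by move=> m y Ey; apply: mule_ge0; [exact: nnfun_muleindic_ge0|rewrite lee_fin].
apply: eq_fsbigr => r; rewrite inE => -[x _ rx].
have r0 : (0 <= r)%R by rewrite -rx.
have mr : measurable (g n @^-1` [set r]) by [].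
under eq_integral do rewrite EFinM.
rewrite ge0_integralZl_EFin //; last by apply/measurable_EFinP.
under [RHS]eq_integral do rewrite EFinM -muleA.
rewrite [RHS]ge0_integralZl_EFin //; last 2 first.
- by move=> y _; rewrite mule_ge0 ?lee_fin.
- by apply: emeasurable_funM => //; apply/measurable_EFinP.
congr (_ * _); rewrite integral_indic // setIT m2E // integral_mkcond.
by apply: eq_integral => y _; rewrite epatch_indic muleC.
Qed.
End Density.

Section ConditionalDensity.
Local Open Scope ereal_scope.
Context (R : realType) (d d' d1 : measure_display) (Omega : measurableType d)
  (X : measurableType d') (S : measurableType d1).
Variables (P : probability Omega R) (M : probability X R).
Variables (H : Omega -> S) (Y : Omega -> X) (k : S -> X -> R).
Hypothesis mH : measurable_fun setT H.
Hypothesis mY : measurable_fun setT Y.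
Hypothesis mk : measurable_fun setT (fun z : S * X => k z.1 z.2).
Hypothesis k0 : forall s x, (0 <= k s x)%R.
Hypothesis rect : forall (A : set S) (B : set X), measurable A -> measurable B ->
  P (H @^-1` A `&` Y @^-1` B) =
  \int[P]_(omega in H @^-1` A) \int[M]_(x in B) (k (H omega) x)%:E.

Let HX (z : Omega * X) : S * X := (H z.1, z.2).
Let HY (omega : Omega) : S * X := (H omega, Y omega).
Let kO (z : Omega * X) : R := k (H z.1) z.2.

Let mHX : measurable_fun setT HX.
Proof. by apply: measurable_fun_pair;
  [exact: (measurableT_comp mH measurable_fst)|exact: measurable_snd]. Qed.

Let mHY : measurable_fun setT HY.
Proof. exact: measurable_fun_pair. Qed.

Lemma measurable_cond_density : measurable_fun setT kO.
Proof. exact: (measurableT_comp mk mHX). Qed.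

(** The product-set identity that defines a conditional density says that two
    finite measures on [S * X] agree on measurable rectangles: the law of
    [(H, Y)], and the image under [(H, id)] of the measure with density [k] on
    [Omega * X]. Hence they are equal. *)
Lemma ge0_integral_cond_density (phi : S * X -> \bar R) :
  measurable_fun setT phi -> (forall z, 0 <= phi z) ->
  \int[P]_omega phi (H omega, Y omega) =
  \int[P \x M]_z (phi (H z.1, z.2) * (k (H z.1) z.2)%:E).
Proof.
move=> mphi phi0.
have mkO := measurable_cond_density.
have kO0 z : (0 <= kO z)%R by exact: k0.
pose m1_ : {measure set (S * X) -> \bar R} := pushforward P HY.
pose m1 := m1_ mHY.
pose mu_ : {measure set (Omega * X) -> \bar R} := mdensity (P \x M) kO.
pose mu := mu_ mkO kO0.
pose m2_ : {measure set (S * X) -> \bar R} := pushforward mu HX.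
pose m2 := m2_ mHX.
have m12 C : measurable C -> m1 C = m2 C.
  apply: (measure_unique
    [set A `*` B | A in measurable & B in measurable] (fun=> setT)) => //.
  - exact: measurable_prod_measurableType.
  - move=> _ _ [A mA [B mB <-]] [A' mA' [B' mB' <-]].
    exists (A `&` A'); first exact: measurableI.
    by exists (B `&` B'); [exact: measurableI|rewrite setXI].
  - by move=> _; exists setT => //; exists setT => //; rewrite setXTT.
  - by rewrite bigcup_const.
  - move=> _ [A mA [B mB <-]].
    transitivity (P (H @^-1` A `&` Y @^-1` B)); first by [].
    transitivity (\int[P \x M]_(z in (H @^-1` A) `*` B) (kO z)%:E); last by [].
    rewrite rect //.
    have mHA : measurable (H @^-1` A) by rewrite -[X in measurable X]setTI;
      exact: mH.
    rewrite [RHS]integral_mkcond fubini_tonelli1; last 2 first.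
    + apply/(measurable_restrictT _ (measurableX mHA mB)).
      by apply/measurable_EFinP; exact: measurable_funTS.
    + by move=> z; apply: erestrict_ge0 => ? _; rewrite lee_fin.
    rewrite integral_mkcond; apply: eq_integral => omega _.
    rewrite /fubini_F /= patchE; case: ifPn => oA.
      rewrite integral_mkcond; apply: eq_integral => x _.
      by rewrite !patchE in_setX /= oA.
    rewrite integral0_eq // => x _.
    by rewrite patchE in_setX /= (negbTE oA).
  - move=> _; have -> : m1 setT = P setT by [].
    by rewrite probability_setT ltry.
transitivity (\int[m1]_z phi z).
  by rewrite /m1 ge0_integral_pushforward.
transitivity (\int[m2]_z phi z).
  by apply: eq_measure_integral => A mA _; exact: m12.
rewrite /m2 ge0_integral_pushforward // preimage_setT.
rewrite (ge0_integral_density (mu := P \x M) mkO) //.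
  exact: measurableT_comp.
by move=> z; exact: phi0.
Qed.

End ConditionalDensity.

Lemma ge0_integral_law (R : realType) (d d' : measure_display)
    (Omega : measurableType d) (X : measurableType d')
    (P : {measure set Omega -> \bar R}) (M : {measure set X -> \bar R})
    (Y : Omega -> X) (f : X -> \bar R) :
  measurable_fun setT Y ->
  (forall A, measurable A -> P (Y @^-1` A) = M A) ->
  measurable_fun setT f -> (forall x, 0 <= f x)%E ->
  (\int[P]_omega f (Y omega) = \int[M]_x f x)%E.
Proof.
move=> mY law mf f0.
pose m_ : {measure set X -> \bar R} := pushforward P Y.
transitivity (\int[m_ mY]_x f x)%E.
  by rewrite /m_ [RHS]ge0_integral_pushforward.
by apply: eq_measure_integral => A mA _; exact: law.
Qed.

(** * Measurability and moments of the discrete recursion *)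

Lemma sqr_sum_le (R : realFieldType) (I : finType) (u : I -> R) :
  (\sum_i u i) ^+ 2 <= #|I|%:R * \sum_i u i ^+ 2.
Proof.
rewrite expr2 big_distrlr /=.
apply: (@le_trans _ _ (\sum_i \sum_j (u i ^+ 2 + u j ^+ 2) / 2)).
  apply: ler_sum => i _; apply: ler_sum => j _.
  have := sqr_ge0 (u i - u j); nra.
have inner i : \sum_j (u i ^+ 2 + u j ^+ 2) / 2 =
    #|I|%:R / 2 * u i ^+ 2 + (\sum_j u j ^+ 2) / 2.
  rewrite -mulr_suml big_split /= sumr_const -[_ *+ #|_|]mulr_natl.
  by rewrite mulrDl mulrAC.
rewrite (eq_bigr _ (fun i _ => inner i)) big_split /= -mulr_sumr sumr_const.
rewrite -[_ *+ #|_|]mulr_natl.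
set T := \sum_i _; lra.
Qed.

Lemma integral_prod_mul (R : realType) (d d' : measure_display)
    (T : measurableType d) (X : measurableType d')
    (P : {sigma_finite_measure set T -> \bar R})
    (M : {sigma_finite_measure set X -> \bar R}) (f : T -> R) (g : X -> R) :
  measurable_fun setT f -> measurable_fun setT g ->
  (forall x, 0 <= f x) -> (forall x, 0 <= g x) ->
  (\int[P \x M]_z (f z.1 * g z.2)%:E =
   \int[P]_x (f x)%:E * \int[M]_x (g x)%:E)%E.
Proof.
move=> mf mg f0 g0.
rewrite fubini_tonelli1; last 2 first.
- apply/measurable_EFinP; apply: measurable_funM.
    exact: (measurableT_comp mf measurable_fst).
  exact: (measurableT_comp mg measurable_snd).
- by move=> z; rewrite lee_fin mulr_ge0.
have G0 : (0 <= \int[M]_x (g x)%:E)%E by apply: integral_ge0 => x _;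
  rewrite lee_fin.
rewrite -ge0_integralZr //; last 2 first.
- exact/measurable_EFinP.
- by move=> x _; rewrite lee_fin.
apply: eq_integral => x _; rewrite /fubini_F /=.
under eq_integral do rewrite EFinM.
rewrite ge0_integralZl_EFin //; last exact/measurable_EFinP.
by move=> y _; rewrite lee_fin.
Qed.

Lemma integral_cst_probability (R : realType) (d : measure_display)
    (T : measurableType d) (Q : probability T R) (r : R) :
  (\int[Q]_x r%:E = r%:E)%E.
Proof.
rewrite integral_cst // -[RHS]mule1; congr (_ * _)%E; exact: probability_setT.
Qed.

Section RecursionMeasurability.
Context (R : realType) (I : finType) (d d' : measure_display)
  (T : measurableType d) (X : measurableType d').
Variables (s : I -> X -> R) (w : nat -> R) (g0 : I -> R).
Hypothesis ms : forall i, measurable_fun setT (s i).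
Hypothesis s_gt0 : forall i x, 0 < s i x.
Hypothesis w01 : forall n, (1 <= n)%N -> 0 < w n <= 1.
Hypothesis g0_gt0 : forall i, 0 < g0 i.
Hypothesis g0_sum : \sum_i g0 i = 1.

Lemma measurable_mixden (g : T -> I -> R) (x : T -> X) :
  (forall i, measurable_fun setT (g ^~ i)) -> measurable_fun setT x ->
  measurable_fun setT (fun t => mixden s (g t) (x t)).
Proof.
move=> mg mx; apply: measurable_sum => i; apply: measurable_funM => //.
exact: measurableT_comp.
Qed.

Lemma measurable_discrete_rec (xs : nat -> T -> X) n i :
  (forall j, (1 <= j <= n)%N -> measurable_fun setT (xs j)) ->
  measurable_fun setT (fun t => discrete_rec s w g0 (xs ^~ t) n i).
Proof.
elim: n i => [|n IH] i mxs; first exact: measurable_cst.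
have {}IH k : measurable_fun setT (fun t => discrete_rec s w g0 (xs ^~ t) n k).
  by apply: IH => j /andP[j1 jn]; apply: mxs; rewrite j1 ltnW.
have mx : measurable_fun setT (xs n.+1) by apply: mxs; rewrite /= leqnn.
rewrite /= /bayes_step; apply: measurable_funD; first exact: measurable_funM.
apply: measurable_funM => //; apply: measurable_funM.
  by apply: measurable_funM => //; exact: measurableT_comp.
apply: measurable_fun_inv; first exact: measurable_mixden.
by move=> t; apply/ltW/mixden_gt0 => //; exact: discrete_rec_dist.
Qed.

Lemma measurable_inv_mixden_rec (xs : nat -> T -> X) n (x : T -> X) :
  (forall j, (1 <= j <= n)%N -> measurable_fun setT (xs j)) ->
  measurable_fun setT x ->
  measurable_fun setT (fun t =>
    (mixden s (discrete_rec s w g0 (xs ^~ t) n) (x t))^-1).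
Proof.
move=> mxs mx; apply: measurable_fun_inv.
  by apply: measurable_mixden => // i; exact: measurable_discrete_rec.
by move=> t; apply/ltW/mixden_gt0 => //; exact: discrete_rec_dist.
Qed.

End RecursionMeasurability.

Lemma measurable_envelope (R : realType) (I : finType) (d : measure_display)
    (X : measurableType d) (s : I -> X -> R) (a : I -> R) :
  (forall i, measurable_fun setT (s i)) -> (forall i x, 0 < s i x) ->
  measurable_fun setT (envelope s a).
Proof.
move=> ms s0; apply: measurable_funM => //; apply: measurable_sum => i.
by apply: measurable_fun_inv => // x; exact: ltW.
Qed.

Lemma envelope_sq_integrable (R : realType) (I : finType) (d : measure_display)
    (X : measurableType d) (M : {measure set X -> \bar R})
    (s : I -> X -> R) (a : I -> R) :
  (forall i, measurable_fun setT (s i)) -> (forall i x, 0 < s i x) ->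
  (forall i, \int[M]_x ((s i x)^-1 ^+ 2)%:E < +oo)%E ->
  (\int[M]_x (envelope s a x ^+ 2)%:E < +oo)%E.
Proof.
move=> ms s0 hs.
have mi i : measurable_fun setT (fun x => (s i x)^-1 ^+ 2).
  by apply: measurable_funX; apply: measurable_fun_inv => // x; exact: ltW.
pose K := weight_cst a ^+ 2 * #|I|%:R.
have K0 : 0 <= K by rewrite mulr_ge0 ?sqr_ge0.
apply: (@le_lt_trans _ _ (\int[M]_x (K%:E * \sum_i ((s i x)^-1 ^+ 2)%:E))%E).
  apply: ge0_le_integral => //.
  - by move=> x _; rewrite lee_fin sqr_ge0.
  - apply/measurable_EFinP; apply: measurable_funX; exact: measurable_envelope.
  - apply: emeasurable_funM => //; apply: emeasurable_sum => i.
    exact/measurable_EFinP.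
  - move=> x _; rewrite sumEFin -EFinM lee_fin /envelope exprMn /K -[leRHS]mulrA.
    by apply: ler_wpM2l; [exact: sqr_ge0|exact: sqr_sum_le].
rewrite ge0_integralZl_EFin //; last 2 first.
- by move=> x _; rewrite sumEFin lee_fin sumr_ge0 // => i _; rewrite sqr_ge0.
- by apply: emeasurable_sum => i; exact/measurable_EFinP.
rewrite ge0_integral_sum //; last 2 first.
- by move=> i; exact/measurable_EFinP.
- by move=> i x _; rewrite lee_fin sqr_ge0.
rewrite lte_mul_pinfty ?lee_fin //.
by apply: lte_sum_pinfty => i _; exact: hs.
Qed.

(** * Convergence when the observations have reference law M *)

Section Core.
Context (R : realType) (d d' : measure_display) (Omega : measurableType d)
  (X : measurableType d') (P : probability Omega R) (M : probability X R)
  (I : finType).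
Variables (s : I -> X -> R) (a g0 : I -> R) (w : nat -> R)
  (Y : nat -> Omega -> X)
  (k : forall i : nat, nat -> i.-tuple X -> X -> R) (c0 rho : R).
Hypothesis ms : forall i, measurable_fun setT (s i).
Hypothesis s_gt0 : forall i x, 0 < s i x.
Hypothesis a_gt0 : forall i, 0 < a i.
Hypothesis a_sum : \sum_i a i = 1.
Hypothesis as_sum : forall x, mixden s a x = 1.
Hypothesis g0_gt0 : forall i, 0 < g0 i.
Hypothesis g0_sum : \sum_i g0 i = 1.
Hypothesis wP : weights w.
Hypothesis mY : forall n, (1 <= n)%N -> measurable_fun setT (Y n).
Hypothesis lawY : forall n, (1 <= n)%N -> forall A, measurable A ->
  P (Y n @^-1` A) = M A.
Hypothesis condY : forall i n, (1 <= i)%N -> (1 <= n)%N ->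
  is_cond_density P M (history Y i) (Y (i + n)%N) (@k i n).
Hypothesis rho01 : 0 < rho < 1.
Hypothesis depY : forall i n, (1 <= i)%N -> (1 <= n)%N ->
  (\int[P]_omega \int[M]_x ((k n (history Y i omega) x - 1) ^+ 2)%:E
   <= (c0 ^+ 2 * rho ^+ (2 * n))%:E)%E.
Hypothesis s_int : forall i, (\int[M]_x (s i x)%:E <= 1)%E.
Hypothesis s_sq : forall i, (\int[M]_x ((s i x)^-1 ^+ 2)%:E < +oo)%E.

Let D := envelope s a.
Let pi n omega := discrete_rec s w g0 (Y ^~ omega) n.

Let w01 : forall n, (1 <= n)%N -> 0 < w n <= 1.
Proof. by case: wP. Qed.

Let pi_dist n omega : distribution_on (pi n omega).
Proof. exact: discrete_rec_dist. Qed.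

Let mix_gt0 n omega x : 0 < mixden s (pi n omega) x.
Proof. exact: mixden_gt0. Qed.

Let E2 : R := fine (\int[M]_x (D x ^+ 2)%:E).

Let mD : measurable_fun setT D.
Proof. exact: measurable_envelope. Qed.

Let mD2 : measurable_fun setT (fun x => D x ^+ 2).
Proof. exact: measurable_funX. Qed.

Let E2E : (\int[M]_x (D x ^+ 2)%:E = E2%:E)%E.
Proof.
rewrite /E2 fineK // ge0_fin_numE; first exact: envelope_sq_integrable.
by apply: integral_ge0 => x _; rewrite lee_fin sqr_ge0.
Qed.

Let E2Y n : (1 <= n)%N -> (\int[P]_omega (D (Y n omega) ^+ 2)%:E = E2%:E)%E.
Proof.
move=> n1; rewrite -E2E.
apply: (ge0_integral_law (f := fun x => (D x ^+ 2)%:E) (mY n1) (lawY n1)).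
  exact/measurable_EFinP.
by move=> x; rewrite lee_fin sqr_ge0.
Qed.

Let inv_mix_le n omega x : (mixden s (pi n omega) x)^-1 <= D x ^+ 2.
Proof.
have D1 := envelope_ge1 s_gt0 a_gt0 a_sum as_sum x.
apply: (le_trans (inv_mixden_le s_gt0 a_gt0 a_sum (pi_dist n omega) x)).
by rewrite expr2 ler_peMr // (le_trans ler01).
Qed.

Let mpi n i : measurable_fun setT (fun omega => pi n omega i).
Proof.
apply: (measurable_discrete_rec ms s_gt0 w01 g0_gt0 g0_sum).
by move=> j /andP[j1 _]; exact: mY.
Qed.

Let mpi1 n i : measurable_fun setT (fun z : Omega * X => pi n z.1 i).
Proof. exact: (measurableT_comp (mpi n i) measurable_fst). Qed.

Let mmix n : measurable_fun setT (fun z : Omega * X => mixden s (pi n z.1) z.2).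
Proof. exact: (measurable_mixden (g := fun z : Omega * X => pi n z.1) (x :=
  snd) ms (mpi1 n)). Qed.

(** [b n j] evaluates the iterate [j] at the actual observation [n]; [c j] and
    [q j] evaluate it at a fresh observation, independent of the history. *)
Let b n j : \bar R :=
  (\int[P]_omega ((mixden s (pi j omega) (Y n omega))^-1)%:E)%E.
Let c j : \bar R :=
  (\int[P \x M]_z ((mixden s (pi j z.1) z.2)^-1)%:E)%E.
Let q j : \bar R :=
  (\int[P \x M]_z ((1 - mixden s (pi j z.1) z.2) ^+ 2)%:E)%E.

Let minv n : measurable_fun setT (fun z : Omega * X =>
  (mixden s (pi n z.1) z.2)^-1).
Proof. by apply: measurable_fun_inv => // z; exact: ltW. Qed.

Let minvY n j : (1 <= n)%N ->
  measurable_fun setT (fun omega => (mixden s (pi j omega) (Y n omega))^-1).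
Proof.
move=> n1; apply: measurable_fun_inv => [|omega]; last exact: ltW.
exact: (measurable_mixden (g := fun omega => pi j omega) ms (mpi j) (mY n1)).
Qed.

Let b_fin n j : (1 <= n)%N -> b n j \is a fin_num.
Proof.
move=> n1; rewrite ge0_fin_numE; last first.
  by apply: integral_ge0 => omega _; rewrite lee_fin invr_ge0 ltW.
apply: (@le_lt_trans _ _ E2%:E); last exact: ltry.
rewrite -(E2Y n1); apply: ge0_le_integral => //.
- by move=> omega _; rewrite lee_fin invr_ge0 ltW.
- exact/measurable_EFinP/minvY.
- by apply/measurable_EFinP; exact: (measurableT_comp mD2 (mY n1)).
- by move=> omega _; rewrite lee_fin.
Qed.

Let int_sndE (f : X -> R) : measurable_fun setT f -> (forall x, 0 <= f x) ->
  (\int[P \x M]_z (f z.2)%:E = \int[M]_x (f x)%:E)%E.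
Proof.
move=> mf f0.
have P1 : (\int[P]_x ((fun=> 1%R) x)%:E = 1)%E.
  exact: integral_cst_probability.
rewrite -[RHS]mul1e -P1 -integral_prod_mul //.
by apply: eq_integral => z _; rewrite mul1r.
Qed.

Let c_fin j : c j \is a fin_num.
Proof.
rewrite ge0_fin_numE; last first.
  by apply: integral_ge0 => omega _; rewrite lee_fin invr_ge0 ltW.
apply: (@le_lt_trans _ _ E2%:E); last exact: ltry.
rewrite -E2E -int_sndE //; last by move=> x; exact: sqr_ge0.
apply: ge0_le_integral => //.
- by move=> omega _; rewrite lee_fin invr_ge0 ltW.
- exact/measurable_EFinP.
- by apply/measurable_EFinP; exact: (measurableT_comp mD2 measurable_snd).
- by move=> z _; rewrite lee_fin.
Qed.

Let b0E n : (1 <= n)%N -> b n 0 = c 0.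
Proof.
move=> n1.
have mf : measurable_fun setT (fun x => (mixden s g0 x)^-1).
  apply: measurable_fun_inv.
    by apply: measurable_sum => i; apply: measurable_funM.
  by move=> x; exact/ltW/(mix_gt0 0 point).
have f0 x : 0 <= (mixden s g0 x)^-1 by rewrite invr_ge0 ltW // (mix_gt0 0 point).
rewrite /c (int_sndE mf) //.
apply: (ge0_integral_law (f := fun x => ((mixden s g0 x)^-1)%:E) (mY n1) (lawY n1)).
  exact/measurable_EFinP.
by move=> x; rewrite lee_fin.
Qed.

Let K : R := (E2 ^+ 2 + c0 ^+ 2) / 2.

(** The iterate as a function of the tuple of observations: the conditional
    densities are functions of that tuple. Observation [l] is at position
    [l.-1]. *)
Let piS i j (t : i.-tuple X) := discrete_rec s w g0 (fun l => nth point t l.-1) j.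

Let piSE i j omega : (j <= i)%N -> piS j (history Y i omega) = pi j omega.
Proof.
move=> ji; apply: discrete_rec_eq => l /andP[l1 lj].
have li : (l.-1 < i)%N by rewrite prednK // (leq_trans lj).
rewrite /history -(tnth_nth point _ (Ordinal li)) tnth_mktuple /=.
by rewrite prednK.
Qed.

Let mhist i : measurable_fun setT (history Y i).
Proof.
apply/measurable_fun_tnthP => j.
rewrite (_ : _ \o _ = Y j.+1); first exact: mY.
by apply/funext => omega /=; rewrite tnth_mktuple.
Qed.

(** For [j <= i], the iterate [j] is a function of the history up to [i], so
    the conditional density of the observation [i + l] given that history
    applies. *)
Let b_joint i l j : (1 <= i)%N -> (1 <= l)%N -> (j <= i)%N ->
  (b (i + l) j = \int[P \x M]_z ((mixden s (pi j z.1) z.2)^-1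
                    * k l (history Y i z.1) z.2)%:E)%E.
Proof.
move=> i1 l1 ji.
have [mk k0 rect] := condY i1 l1.
have il1 : (1 <= i + l)%N by rewrite (leq_trans i1) // leq_addr.
pose phi (z : i.-tuple X * X) : \bar R := ((mixden s (piS j z.1) z.2)^-1)%:E.
have := @ge0_integral_cond_density R _ _ _ Omega X _ P M (history Y i) (Y (i + l)%N)
  (@k i l) (@mhist i) (mY il1) mk k0 rect phi.
have mphi : measurable_fun setT phi.
  apply/measurable_EFinP.
  apply: (measurable_inv_mixden_rec ms s_gt0 w01 g0_gt0 g0_sum) => //.
  move=> m /andP[m1 mj].
  have mi : (m.-1 < i)%N by rewrite prednK // (leq_trans mj).
  rewrite (_ : (fun z : i.-tuple X * X => _) =
    (fun t => tnth t (Ordinal mi)) \o fst).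
    by apply: measurableT_comp => //; exact: measurable_tnth.
  by apply/funext => z /=; rewrite (tnth_nth point).
have phi0 z : (0 <= phi z)%E.
  rewrite lee_fin invr_ge0 ltW //; apply: mixden_gt0 => //.
  exact: discrete_rec_dist.
move=> /(_ mphi phi0).
rewrite /b /phi /=.
under eq_integral do rewrite piSE //.
move=> ->; apply: eq_integral => z _; rewrite /= piSE //.
Qed.

(** The gap [c - b] between a fresh and the actual observation grows by at most
    [w * rho ^ lag * K] at each step. With [r_j] the inverse mixture density
    and [k] the conditional density, the growth is the integral of
    [(r_(j+1) - r_j) (1 - k)]; the first factor is at most [w D D], and the
    inequality between means, with the weight [rho ^ lag] that balances the two
    terms, separates the moments of [D] from the chi-square distance of [k]
    from 1. Stated with sums of nonnegative integrals, to avoid subtraction. *)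
Let cb_step j l :
  (b (j.+1 + l.+1) j + c j.+1 <=
   b (j.+1 + l.+1) j.+1 + c j + (w j.+1 * rho ^+ l.+1 * K)%:E)%E.
Proof.
have [mk k0 _] := condY (ltn0Sn j) (ltn0Sn l).
have /andP[w0 w1] := w01 (ltn0Sn j).
have /andP[r0 r1] := rho01.
set kO := fun z : Omega * X => k l.+1 (history Y j.+1 z.1) z.2.
have mkO : measurable_fun setT kO
  by exact: (measurable_cond_density (@mhist j.+1) mk).
have kO0 z : 0 <= kO z by exact: k0.
rewrite !b_joint //.
pose r m (z : Omega * X) := (mixden s (pi m z.1) z.2)^-1.
have r_ge0 m z : 0 <= r m z by rewrite invr_ge0 ltW.
pose DD (z : Omega * X) := D (Y j.+1 z.1) ^+ 2 * D z.2 ^+ 2.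
have mY1 : measurable_fun setT (fun omega => D (Y j.+1 omega) ^+ 2).
  exact: (measurableT_comp mD2 (mY (ltn0Sn j))).
have mDD : measurable_fun setT DD.
  apply: measurable_funM; first exact: (measurableT_comp mY1 measurable_fst).
  exact: (measurableT_comp mD2 measurable_snd).
have DD0 z : 0 <= DD z by rewrite mulr_ge0 // sqr_ge0.
pose u := w j.+1 / 2 * rho ^+ l.+1.
pose v := w j.+1 / 2 / rho ^+ l.+1.
have rl : 0 < rho ^+ l.+1 by rewrite exprn_gt0.
have u0 : 0 <= u by apply: mulr_ge0; [apply: divr_ge0|]; exact: ltW.
have v0 : 0 <= v by apply: divr_ge0; [apply: divr_ge0|]; exact: ltW.
have mkk : measurable_fun setT (fun z => (kO z - 1) ^+ 2).
  by apply: measurable_funX; exact: measurable_funB.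
have pw z : r j z * kO z + r j.+1 z <= r j.+1 z * kO z + r j z + (u * DD z + v * (kO z - 1) ^+ 2).
  have := inv_mixden_step s_gt0 a_gt0 a_sum as_sum (pi_dist j z.1) (Y j.+1 z.1) (w01 (ltn0Sn j)) z.2.
  rewrite -/(r j z) -/(pi j.+1 z.1) -/(r j.+1 z) => lip.
  pose B := D (Y j.+1 z.1) * D z.2.
  have B0 : 0 <= B.
    by apply: mulr_ge0; apply/ltW/(envelope_gt0 s_gt0 a_gt0 a_sum as_sum).
  have -> : u * DD z + v * (kO z - 1) ^+ 2 =
     w j.+1 * ((rho ^+ l.+1 * B ^+ 2 + (kO z - 1) ^+ 2 / rho ^+ l.+1) / 2).
    by rewrite /u /v /DD /B; ring.
  have amgm : B * `|kO z - 1| <= (rho ^+ l.+1 * B ^+ 2 + (kO z - 1) ^+ 2 / rho ^+ l.+1) / 2.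
    set t := `|kO z - 1|.
    have -> : (kO z - 1) ^+ 2 = t ^+ 2 by rewrite /t real_normK ?num_real.
    set p := rho ^+ l.+1 in rl *.
    have : 0 <= (p * B - t) ^+ 2 / p by rewrite divr_ge0 ?sqr_ge0 // ltW.
    have -> : (p * B - t) ^+ 2 / p = p * B ^+ 2 + t ^+ 2 / p - 2 * (B * t).
      by field; rewrite gt_eqF.
    lra.
  have h1 : (r j.+1 z - r j z) * (1 - kO z) <= w j.+1 * (B * `|kO z - 1|).
    apply: (le_trans (ler_norm _)); rewrite normrM (distrC 1) mulrA.
    by rewrite ler_wpM2r.
  have h2 := ler_wpM2l (ltW w0) amgm.
  move: h1 h2; set Z := (w j.+1 * (_ / 2)).
  lra.
have I1 (f : Omega * X -> R) : measurable_fun setT f ->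
    measurable_fun setT (fun z => (f z)%:E) by move=> ?; exact/measurable_EFinP.
have nn (f : Omega * X -> R) : (forall z, 0 <= f z) ->
    forall z : Omega * X, setT z -> (0 <= (f z)%:E)%E by move=> h z _;
      rewrite lee_fin.
have mrk m : measurable_fun setT (fun z => r m z * kO z).
  by apply: measurable_funM => //; exact: minv.
have rk0 m z : 0 <= r m z * kO z by exact: mulr_ge0.
rewrite /c -ge0_integralD //;
  [|exact: (nn _ (rk0 j))|exact: (I1 _ (mrk j))|exact: (nn _ (r_ge0 j.+1))
   |exact: (I1 _ (minv j.+1))].
apply: (@le_trans _ _ (\int[P \x M]_z ((r j.+1 z * kO z)%:E + (r j z)%:E
     + (u * DD z + v * (kO z - 1) ^+ 2)%:E))%E).
  apply: ge0_le_integral => //.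
  - by move=> z _; rewrite -EFinD lee_fin; exact: addr_ge0 (rk0 j z) (r_ge0 j.+1 z).
  - apply: emeasurable_funD; first exact: (I1 _ (mrk j)).
    exact: (I1 _ (minv j.+1)).
  - apply: emeasurable_funD.
      apply: emeasurable_funD; first exact: (I1 _ (mrk j.+1)).
      exact: (I1 _ (minv j)).
    by apply: I1; apply: measurable_funD; exact: measurable_funM.
  - by move=> z _; rewrite -!EFinD lee_fin; exact: pw.
have uvm : measurable_fun setT (fun z => u * DD z + v * (kO z - 1) ^+ 2).
  by apply: measurable_funD; exact: measurable_funM.
have uv0 z : 0 <= u * DD z + v * (kO z - 1) ^+ 2.
  by rewrite addr_ge0 // mulr_ge0 // sqr_ge0.
rewrite ge0_integralD //; last 4 first.
- by move=> z _; rewrite -EFinD lee_fin; exact: addr_ge0 (rk0 j.+1 z) (r_ge0 j z).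
- apply: emeasurable_funD; first exact: (I1 _ (mrk j.+1)).
  exact: (I1 _ (minv j)).
- exact: (nn _ uv0).
- exact: (I1 _ uvm).
rewrite ge0_integralD //;
  [|exact: (nn _ (rk0 j.+1))|exact: (I1 _ (mrk j.+1))|exact: (nn _ (r_ge0 j))
   |exact: (I1 _ (minv j))].
apply: leeD2l.
have mu1 : measurable_fun setT (fun z => u * DD z) by exact: measurable_funM.
have mv1 : measurable_fun setT (fun z => v * (kO z - 1) ^+ 2)
  by exact: measurable_funM.
have -> : (\int[P \x M]_z (u * DD z + v * (kO z - 1) ^+ 2)%:E =
   \int[P \x M]_z (u * DD z)%:E + \int[P \x M]_z (v * (kO z - 1) ^+ 2)%:E)%E.
  rewrite -ge0_integralD //.
  - by move=> z _; rewrite lee_fin mulr_ge0.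
  - exact: I1.
  - by move=> z _; rewrite lee_fin mulr_ge0 // sqr_ge0.
  - exact: I1.
have -> : (\int[P \x M]_z (u * DD z)%:E = (u * E2 ^+ 2)%:E)%E.
  under eq_integral do rewrite EFinM.
  rewrite ge0_integralZl_EFin //; [|exact: (nn _ DD0)|exact: (I1 _ mDD)].
  rewrite (integral_prod_mul P M mY1 mD2) //; last 2 first.
  - by move=> omega; exact: sqr_ge0.
  - by move=> x; exact: sqr_ge0.
  by rewrite E2Y // E2E -!EFinM.
have -> : (\int[P \x M]_z (v * (kO z - 1) ^+ 2)%:E =
    v%:E * \int[P \x M]_z ((kO z - 1) ^+ 2)%:E)%E.
  under eq_integral do rewrite EFinM.
  rewrite ge0_integralZl_EFin //; last exact: I1.
  by apply: nn => z; exact: sqr_ge0.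
have dep : (\int[P \x M]_z ((kO z - 1) ^+ 2)%:E <= (c0 ^+ 2 * rho ^+ (2 * l.+1))%:E)%E.
  rewrite fubini_tonelli1; last 2 first.
  - exact: I1.
  - by move=> z; rewrite lee_fin sqr_ge0.
  exact: (depY (ltn0Sn j) (ltn0Sn l)).
apply: (@le_trans _ _ ((u * E2 ^+ 2)%:E + v%:E * (c0 ^+ 2 * rho ^+ (2 * l.+1))%:E)%E).
  by apply: leeD2l; apply: lee_wpmul2l; rewrite ?lee_fin.
rewrite -EFinM -EFinD lee_fin le_eqVlt; apply/orP; left; apply/eqP.
rewrite /u /v /K mulnC exprM.
set p := rho ^+ l.+1 in rl *.
by field; rewrite gt_eqF.
Qed.

Let L := weight_cst a.
Let L1 : 1 <= L. Proof. exact: weight_cst_ge1 a_gt0 a_sum. Qed.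
Let cr j := fine (c j).
Let br n j := fine (b n j).
Let qr j := fine (q j).
Let mean_dist h : \bar R := (\int[M]_x ((1 - mixden s h x) ^+ 2)%:E)%E.

Let cE j : c j = (cr j)%:E. Proof. by rewrite fineK. Qed.
Let bE n j : (1 <= n)%N -> b n j = (br n j)%:E.
Proof. by move=> n1; rewrite fineK //; exact: b_fin. Qed.

(** Induction on [j] for all lags at once; [b0E] is the base case, where the
    gap vanishes. *)
Let cb_bound j l : cr j - br (j.+1 + l) j <= K * (rho ^+ l * discounted w rho j).
Proof.
elim: j l => [|j IH] l.
  by rewrite /cr /br b0E // subrr /= !mulr0.
have := cb_step j l.
have ej : (j.+1 + l.+1)%N = (j.+2 + l)%N by rewrite addnS.
rewrite !cE !bE // -!EFinD lee_fin => h.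
have := IH l.+1 => IHl.
rewrite ej in h IHl; rewrite exprS in h IHl; rewrite /=.
set p := rho ^+ l in h IHl *; set dd := discounted w rho j in IHl *.
have -> : K * (p * (rho * (dd + w j.+1))) = K * (rho * p * dd) + w j.+1 * (rho * p) * K by ring.
lra.
Qed.

Let sq_le h x : distribution_on h -> (1 - mixden s h x) ^+ 2 <= (1 + L) ^+ 2.
Proof.
move=> hd; have := mixden_le s_gt0 a_gt0 as_sum hd x.
have := mixden_gt0 s_gt0 hd x; rewrite -/L => h1 h2.
have h3 := L1; nra.
Qed.

Let msq n : measurable_fun setT (fun z : Omega * X =>
  (1 - mixden s (pi n z.1) z.2) ^+ 2).
Proof. by apply: measurable_funX; exact: measurable_funB. Qed.

Let q_fin j : q j \is a fin_num.
Proof.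
rewrite ge0_fin_numE; last first.
  by apply: integral_ge0 => omega _; rewrite lee_fin sqr_ge0.
apply: (@le_lt_trans _ _ (\int[P \x M]_z (((fun=> (1 + L) ^+ 2) :
  X -> R) z.2)%:E)%E).
  apply: ge0_le_integral => //.
  - by move=> z _; rewrite lee_fin sqr_ge0.
  - by apply/measurable_EFinP; exact: msq.
  - by move=> z _; rewrite lee_fin sq_le.
rewrite (@int_sndE (fun=> (1 + L) ^+ 2)) //; last by move=> _; exact: sqr_ge0.
by rewrite integral_cst_probability ltry.
Qed.

Let mixden_int h : distribution_on h -> (\int[M]_x (mixden s h x)%:E <= 1)%E.
Proof.
move=> [h0 h1].
under eq_integral do rewrite /mixden -sumEFin.
rewrite ge0_integral_sum //; last 2 first.
- by move=> i; apply/measurable_EFinP; exact: measurable_funM.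
- by move=> i x _; rewrite lee_fin mulr_ge0 // ltW.
apply: (@le_trans _ _ (\sum_i (h i)%:E)%E); last by rewrite sumEFin h1.
apply: lee_sum => i _; under eq_integral do rewrite EFinM.
rewrite ge0_integralZl_EFin //; last 2 first.
- by move=> x _; rewrite lee_fin ltW.
- exact/measurable_EFinP.
by rewrite -[leRHS]mule1; apply: lee_wpmul2l => //; rewrite lee_fin.
Qed.

Let c_lower j : 1 + L^-1 * qr j <= cr j.
Proof.
have L0 : 0 < L by apply: lt_le_trans L1.
have mS := mmix j.
have Sint : (\int[P \x M]_z (mixden s (pi j z.1) z.2)%:E <= 1)%E.
  rewrite fubini_tonelli1; last 2 first.
  - exact/measurable_EFinP.
  - by move=> z; rewrite lee_fin ltW.
  apply: (@le_trans _ _ (\int[P]_omega 1%:E)%E).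
    apply: ge0_le_integral => //.
    - by move=> omega _; apply: integral_ge0 => x _; rewrite lee_fin ltW.
    - apply: measurable_fun_fubini_tonelli_F; first exact/measurable_EFinP.
      by move=> z; rewrite lee_fin ltW.
    - by move=> omega _; exact: (mixden_int (pi_dist j omega)).
  by rewrite integral_cst_probability.
have h : (2%:E + (L^-1)%:E * q j <= c j + \int[P \x M]_z (mixden s (pi j z.1) z.2)%:E)%E.
  have two : (\int[P \x M]_z (((fun=> 2) : X -> R) z.2)%:E = 2%:E)%E.
    by rewrite (@int_sndE (fun=> 2)) // integral_cst_probability.
  rewrite -two /q -ge0_integralZl_EFin //; last 3 first.
  - by move=> z _; rewrite lee_fin sqr_ge0.
  - by apply/measurable_EFinP; exact: msq.
  - by rewrite invr_ge0 ltW.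
  rewrite /c -!ge0_integralD //.
  - apply: ge0_le_integral => //.
    + by move=> z _;
        rewrite -EFinM -EFinD lee_fin addr_ge0 // mulr_ge0 ?sqr_ge0 // invr_ge0 ltW.
    + apply: emeasurable_funD => //; apply: emeasurable_funM => //;
        by apply/measurable_EFinP; exact: msq.
    + apply: emeasurable_funD; apply/measurable_EFinP => //; exact: minv.
    + move=> z _; rewrite -EFinM -!EFinD lee_fin.
      have := inv_mixden_lower s_gt0 a_gt0 as_sum (pi_dist j z.1) z.2.
      rewrite -/L; lra.
  - by move=> z _; rewrite lee_fin invr_ge0 ltW.
  - by apply/measurable_EFinP; exact: minv.
  - by move=> z _; rewrite lee_fin ltW.
  - exact/measurable_EFinP.
  - by move=> z _; rewrite -EFinM lee_fin mulr_ge0 ?sqr_ge0 // invr_ge0 ltW.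
  - apply: emeasurable_funM => //; by apply/measurable_EFinP; exact: msq.
have : (2%:E + (L^-1)%:E * q j <= c j + 1)%E.
  by apply: (le_trans h); exact: leeD2l.
rewrite cE -(fineK (q_fin j)) -/(qr j) -EFinM -!EFinD lee_fin; lra.
Qed.

Let V0 : R := - \sum_i a i * ln (g0 i).
Let W N : R := \sum_(n < N) w n.+1.
Let W2 N : R := \sum_(n < N) w n.+1 ^+ 2.

Let w0 n : 0 <= w n.+1.
Proof. by have /andP[/ltW] := w01 (ltn0Sn n). Qed.

Let br_sum N : \sum_(n < N) w n.+1 * br n.+1 n <= V0 + W N + 8 * (W2 N * E2).
Proof.
have V00 : 0 <= V0.
  rewrite /V0 oppr_ge0; apply: sumr_le0 => i _.
  rewrite mulr_ge0_le0 ?(ltW (a_gt0 i)) // ln_le0 // -g0_sum.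
  by apply: (@le_sum_of_ge0 R I g0) => k'; exact: ltW.
have mR : measurable_fun setT (fun omega =>
    \sum_(n < N) w n.+1 * (mixden s (pi n omega) (Y n.+1 omega))^-1).
  by apply: measurable_sum => n; apply: measurable_funM => //; exact: minvY.
have mB : measurable_fun setT (fun omega =>
    \sum_(n < N) w n.+1 ^+ 2 * D (Y n.+1 omega) ^+ 2).
  apply: measurable_sum => n; apply: measurable_funM => //.
  exact: (measurableT_comp mD2 (mY (ltn0Sn n))).
have h : (\int[P]_omega (\sum_(n < N) w n.+1 * (mixden s (pi n omega) (Y n.+1 omega))^-1)%:E <=
   \int[P]_omega ((V0 + W N)%:E + 8%:E * (\sum_(n < N) w n.+1 ^+ 2 * D (Y n.+1 omega) ^+ 2)%:E))%E.
  apply: ge0_le_integral => //.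
  - by move=> omega _; rewrite lee_fin sumr_ge0 // => n _;
      rewrite mulr_ge0 // invr_ge0 ltW.
  - exact/measurable_EFinP.
  - by apply: emeasurable_funD => //; apply: emeasurable_funM => //;
      exact/measurable_EFinP.
  - move=> omega _; rewrite -EFinM -EFinD lee_fin.
    exact: (entropy_telescope s_gt0 a_gt0 a_sum as_sum w01 g0_gt0 g0_sum (Y ^~ omega) N).
move: h.
have W0 : 0 <= W N by apply: sumr_ge0.
have B0 omega : 0 <= \sum_(n < N) w n.+1 ^+ 2 * D (Y n.+1 omega) ^+ 2.
  by apply: sumr_ge0 => n _; rewrite mulr_ge0 ?sqr_ge0.
rewrite ge0_integralD //; last 3 first.
- by move=> omega _; rewrite lee_fin addr_ge0.
- by move=> omega _; rewrite mule_ge0 ?lee_fin.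
- by apply: emeasurable_funM => //; exact/measurable_EFinP.
rewrite integral_cst_probability.
rewrite ge0_integralZl_EFin //; last 2 first.
- by move=> omega _; rewrite lee_fin.
- exact/measurable_EFinP.
under eq_integral do rewrite -sumEFin.
rewrite ge0_integral_sum //; last 2 first.
- move=> n; apply/measurable_EFinP; apply: measurable_funM => //.
  exact: (measurableT_comp mD2 (mY (ltn0Sn n))).
- by move=> n omega _; rewrite lee_fin mulr_ge0 ?sqr_ge0.
under [X in (X <= _)%E]eq_integral do rewrite -sumEFin.
rewrite ge0_integral_sum //; last 2 first.
- move=> n; apply/measurable_EFinP; apply: measurable_funM => //.
  exact: (@minvY n.+1 n (ltn0Sn n)).
- by move=> n omega _; rewrite lee_fin mulr_ge0 // invr_ge0 ltW.
rewrite (eq_bigr (fun n : 'I_N => (w n.+1 * br n.+1 n)%:E)); last first.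
  move=> n _; under eq_integral do rewrite EFinM.
  rewrite ge0_integralZl_EFin //; last 2 first.
  - by move=> omega _; rewrite lee_fin invr_ge0 ltW.
  - exact/measurable_EFinP/minvY.
  by rewrite -/(b n.+1 n) bE.
rewrite sumEFin (eq_bigr (fun n : 'I_N => (w n.+1 ^+ 2 * E2)%:E)); last first.
  move=> n _; under eq_integral do rewrite EFinM.
  rewrite ge0_integralZl_EFin //; last 3 first.
  - by move=> omega _; rewrite lee_fin sqr_ge0.
  - by apply/measurable_EFinP; exact: (measurableT_comp mD2 (mY (ltn0Sn n))).
  - exact: sqr_ge0.
  by rewrite E2Y.
by rewrite sumEFin -EFinM -EFinD lee_fin -mulr_suml.
Qed.

(** Combines the Lyapunov bound [br_sum], the comparison [cb_bound] and the
    lower bound [c_lower]; the terms [W N] cancel. *)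
Let q_sum : exists C : R, forall N, \sum_(n < N) w n.+1 * qr n <= C.
Proof.
have [C2 C2P] := weights_sq_bounded wP.
have L0 : 0 < L by apply: lt_le_trans L1.
have /andP[r0 r1] := rho01.
have E20 : 0 <= E2.
  by rewrite /E2 fine_ge0 // integral_ge0 // => x _; rewrite lee_fin sqr_ge0.
have K0 : 0 <= K by rewrite divr_ge0 // addr_ge0 // sqr_ge0.
exists (L * (V0 + 8 * (C2 * E2) + K * (C2 / (1 - rho)))) => N.
rewrite -ler_pdivrMl //.
have h1 : \sum_(n < N) w n.+1 * cr n <=
    \sum_(n < N) w n.+1 * br n.+1 n + K * \sum_(n < N) w n.+1 * discounted w rho n.
  rewrite mulr_sumr -big_split /=; apply: ler_sum => n _.
  have := cb_bound n 0; rewrite expr0 mul1r addn0 => hn.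
  rewrite mulrCA -mulrDr ler_wpM2l //; lra.
have h2 : W N + L^-1 * \sum_(n < N) w n.+1 * qr n <= \sum_(n < N) w n.+1 * cr n.
  rewrite mulr_sumr -big_split /=; apply: ler_sum => n _.
  rewrite mulrCA -[X in X + _]mulr1 -mulrDr ler_wpM2l //; exact: c_lower.
have h3 := br_sum N.
have h4 : \sum_(n < N) w n.+1 * discounted w rho n <= C2 / (1 - rho).
  rewrite ler_pdivlMr ?subr_gt0 // mulrC.
  exact: le_trans (discounted_sum wP N rho01) (C2P N).
have h5 : W2 N * E2 <= C2 * E2 by apply: ler_wpM2r => //; exact: C2P.
have h6 := ler_wpM2l K0 h4.
lra.
Qed.

Let mean_dist_fin h : distribution_on h -> mean_dist h \is a fin_num.
Proof.
move=> hd; rewrite ge0_fin_numE; last first.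
  by apply: integral_ge0 => x _; rewrite lee_fin sqr_ge0.
have mh : measurable_fun setT (mixden s h).
  by apply: measurable_sum => i; exact: measurable_funM.
apply: (@le_lt_trans _ _ (\int[M]_x ((1 + L) ^+ 2)%:E)%E).
  apply: ge0_le_integral => //.
  - by move=> x _; rewrite lee_fin sqr_ge0.
  - by apply/measurable_EFinP; apply: measurable_funX; exact: measurable_funB.
  - by move=> x _; rewrite lee_fin sq_le.
by rewrite integral_cst_probability ltry.
Qed.

Let Q h := fine (mean_dist h).

Let Q_lip h h' : distribution_on h -> distribution_on h' ->
  Q h <= Q h' + (2 * (1 + L) * L) * \sum_i `|h i - h' i|.
Proof.
move=> hd hd'.
have L0 : 0 < L by apply: lt_le_trans L1.
set G := \sum_i _.
have G0 : 0 <= G by apply: sumr_ge0.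
have mh g : measurable_fun setT (mixden s g).
  by apply: measurable_sum => i; exact: measurable_funM.
have mh2 g : measurable_fun setT (fun x => ((1 - mixden s g x) ^+ 2)%:E).
  by apply/measurable_EFinP; apply: measurable_funX; exact: measurable_funB.
have CG : 0 <= 2 * (1 + L) * L * G.
  by rewrite !mulr_ge0 // ?addr_ge0 // ltW.
suff : (mean_dist h <= mean_dist h' + (2 * (1 + L) * L * G)%:E)%E.
  by rewrite -(fineK (mean_dist_fin hd)) -(fineK (mean_dist_fin hd')) -EFinD lee_fin.
have -> : (2 * (1 + L) * L * G)%:E = (\int[M]_x (2 * (1 + L) * L * G)%:E)%E.
  by rewrite integral_cst_probability.
rewrite /mean_dist -ge0_integralD //; last first.
  by move=> x _; rewrite lee_fin sqr_ge0.
apply: ge0_le_integral => //.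
- by move=> x _; rewrite lee_fin sqr_ge0.
- by apply: emeasurable_funD.
move=> x _; rewrite -EFinD lee_fin.
have S0 := mixden_gt0 s_gt0 hd x.
have S1 := mixden_le s_gt0 a_gt0 as_sum hd x.
have S0' := mixden_gt0 s_gt0 hd' x.
have S1' := mixden_le s_gt0 a_gt0 as_sum hd' x.
have dS : `|mixden s h x - mixden s h' x| <= L * G.
  rewrite /mixden -sumrB mulr_sumr (le_trans (ler_norm_sum _ _ _)) //.
  apply: ler_sum => i _; rewrite -mulrBl normrM mulrC (gtr0_norm (s_gt0 i x)).
  by rewrite ler_wpM2r // s_le.
rewrite -/L in S1 S1'.
move: dS; set S := mixden s h x in S0 S1 *; set S' := mixden s h' x in S0' S1' *.
rewrite ler_norml => /andP[d1 d2].
have : (S - S') * (S + S' - 2) <= (L * G) * (2 * (1 + L)).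
  apply: (le_trans (ler_norm _)); rewrite normrM ler_pM ?normr_ge0 //.
    by rewrite ler_norml d1.
  by rewrite ler_norml; apply/andP; split; have := L1; lra.
lra.
Qed.

Hypothesis ident : forall h, distribution_on h ->
  {ae M, forall x, mixden s h x = 1} -> h = a.

Let Q_zero h : distribution_on h -> Q h <= 0 -> h = a.
Proof.
move=> hd Qh; apply: ident => //.
have mh2 : measurable_fun setT (fun x => ((1 - mixden s h x) ^+ 2)%:E).
  apply/measurable_EFinP; apply: measurable_funX; apply: measurable_funB => //.
  by apply: measurable_sum => i; exact: measurable_funM.
have : (\int[M]_x `|((1 - mixden s h x) ^+ 2)%:E| = 0)%E.
  under eq_integral do rewrite gee0_abs ?lee_fin ?sqr_ge0 //.
  apply/eqP; rewrite -/(mean_dist h) eq_le integral_ge0 ?andbT; last first.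
    by move=> x _; rewrite lee_fin sqr_ge0.
  by rewrite -(fineK (mean_dist_fin hd)) lee_fin.
move/(ae_eq_integral_abs M measurableT mh2); apply: filterS => x /(_ Logic.I)/=.
move=> -[] /eqP; rewrite sqrf_eq0 subr_eq0 => /eqP <- //.
Qed.

Let mQ n : measurable_fun setT (fun omega => mean_dist (pi n omega)).
Proof.
apply: (@measurable_fun_fubini_tonelli_F _ _ _ _ _ M
   (fun z : Omega * X => ((1 - mixden s (pi n z.1) z.2) ^+ 2)%:E)).
  by apply/measurable_EFinP; exact: msq.
by move=> z; rewrite lee_fin sqr_ge0.
Qed.

Let qE n : (\int[P]_omega (mean_dist (pi n omega)) = (qr n)%:E)%E.
Proof.
rewrite fineK // /q fubini_tonelli1 //.
  by apply/measurable_EFinP; exact: msq.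
by move=> z; rewrite lee_fin sqr_ge0.
Qed.

Let mean_dist_ge0 h : (0 <= mean_dist h)%E.
Proof. by apply: integral_ge0 => x _; rewrite lee_fin sqr_ge0. Qed.

(** The series [\sum_n w n.+1 * Q (pi n)] has finite expectation, so it
    converges almost surely; the deterministic arguments then apply to each
    trajectory. *)
Theorem discrete_rec_cvg :
  {ae P, forall omega, forall i,
     discrete_rec s w g0 (Y ^~ omega) n i @[n --> \oo] --> a i}.
Proof.
have [C CP] := q_sum.
pose f n omega := ((w n.+1)%:E * mean_dist (pi n omega))%E.
have f0 n omega : (0 <= f n omega)%E by rewrite mule_ge0 ?lee_fin.
have mf n : measurable_fun setT (f n) by apply: emeasurable_funM.
have int_f : (\int[P]_omega (\sum_(0 <= n <oo) f n omega) <= C%:E)%E.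
  rewrite integral_nneseries //.
  apply: lime_le; first by apply: is_cvg_nneseries => n _ _; exact: integral_ge0.
  near=> N; rewrite big_mkord.
  rewrite (eq_bigr (fun n : 'I_N => (w n.+1 * qr n)%:E)); last first.
    by move=> n _; rewrite /f ge0_integralZl_EFin // qE.
  by rewrite sumEFin lee_fin; exact: CP.
have ifin : P.-integrable setT (fun omega => \sum_(0 <= n <oo) f n omega)%E.
  apply/integrableP; split; first by apply: ge0_emeasurable_sum => n _ //.
  apply: (le_lt_trans _ (ltry C)); apply: le_trans int_f.
  rewrite le_eqVlt; apply/orP; left; apply/eqP; apply: eq_integral => omega _.
  by rewrite gee0_abs // nneseries_ge0.
have := integrable_ae measurableT ifin; apply: filterS => omega /(_ Logic.I) fin.
have [S SE] : exists S : R, (\sum_(0 <= n <oo) f n omega = S%:E)%E.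
  by exists (fine (\sum_(0 <= n <oo) f n omega)%E); rewrite fineK.
have Q0 h : distribution_on h -> 0 <= Q h by move=> hd; exact: fine_ge0.
have fE n : f n omega = (w n.+1 * Q (pi n omega))%:E.
  by rewrite EFinM fineK // mean_dist_fin.
have Qcv : Q (pi n omega) @[n --> \oo] --> (0 : R).
  apply: (@excursion_cvg0 R (fun n => w n.+1) _ (1 + 2 * (1 + L) * L * 2) S).
  - exact: w0.
  - by move=> n; exact: Q0.
  - have := L1; nra.
  - exact: weights_sum_unbounded.
  - move=> N; rewrite -lee_fin -SE -sumEFin.
    rewrite (eq_bigr (fun n : 'I_N => f n omega)); last by move=> n _; rewrite fE.
    rewrite -(big_mkord predT (fun n => f n omega)).
    by apply: nneseries_lim_ge => n _ _; exact: f0.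
  - move=> n; have := pi_dist n omega; have := pi_dist n.+1 omega => d1 d2.
    have := bayes_step_l1 s_gt0 (Y n.+1 omega) d2 (w01 (ltn0Sn n)).
    rewrite -/(pi n.+1 omega) => l1.
    have := Q_lip d1 d2; have := Q_lip d2 d1.
    have -> : \sum_i `|pi n omega i - pi n.+1 omega i| =
              \sum_i `|pi n.+1 omega i - pi n omega i|.
      by apply: eq_bigr => i _; rewrite distrC.
    set G := \sum_i _ in l1 *.
    have L0 : 0 <= 2 * (1 + L) * L by have := L1; nra.
    have := ler_wpM2l L0 l1; have := w0 n.
    move: L0; set c1 := 2 * (1 + L) * L; set w1 := w n.+1.
    by move=> L0 wn h1 h2 h3; rewrite ler_norml; apply/andP; split; lra.
exact: (simplex_cvg Q_lip Q_zero (fun n => pi_dist n omega) Qcv).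
Unshelve. all: by end_near.
Qed.
End Core.

(** * Observations with a mixture density *)

(** Monotonicity without measurability, immediate from the definition of the
    integral as a supremum over simple functions. It spares the measurability
    of quotients in the extended reals. *)
Lemma ge0_le_integralT (R : realType) (d : measure_display) (T : measurableType d)
    (mu : {measure set T -> \bar R}) (f g : T -> \bar R) :
  (forall x, 0 <= f x)%E -> (forall x, f x <= g x)%E ->
  (\int[mu]_x f x <= \int[mu]_x g x)%E.
Proof.
move=> f0 fg; have g0 x : (0 <= g x)%E := le_trans (f0 x) (fg x).
rewrite !ge0_integralTE //; apply: le_ereal_sup => _ [h /= hf <-]; exists h => //=.
by move=> x; exact: le_trans (hf x) (fg x).
Qed.

Section Mixture.
Context (R : realType) (d d' : measure_display) (Omega : measurableType d)
  (X : measurableType d') (P : probability Omega R)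
  (nu : {measure set X -> \bar R}) (I : finType).
Variables (p : I -> X -> R) (a g0 : I -> R) (w : nat -> R)
  (Y : nat -> Omega -> X)
  (q : forall i : nat, nat -> i.-tuple X -> X -> R) (c0 rho : R).
Let m := mixden p a.
Hypothesis p_density : forall i, is_density nu (p i).
Hypothesis a_gt0 : forall i, 0 < a i.
Hypothesis a_sum : \sum_i a i = 1.
Hypothesis g0_gt0 : forall i, 0 < g0 i.
Hypothesis g0_sum : \sum_i g0 i = 1.
Hypothesis wP : weights w.
Hypothesis mY : forall n, (1 <= n)%N -> measurable_fun setT (Y n).
Hypothesis lawY : forall n, (1 <= n)%N -> has_density P nu (Y n) m.
Hypothesis condY : forall i n, (1 <= i)%N -> (1 <= n)%N ->
  is_cond_density P nu (history Y i) (Y (i + n)%N) (@q i n).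
Hypothesis rho01 : 0 < rho < 1.
Hypothesis depY : geometric_dependence P nu Y m q c0 rho.
Hypothesis moments : forall i j l,
  (\int[nu]_x (((p i x)%:E / (p j x)%:E) ^+ 2 * (p l x)%:E) < +oo)%E.
Hypothesis ident : forall h, distribution_on h ->
  {ae nu, forall x, mixden p h x = m x} -> h = a.

Let mp i : measurable_fun setT (p i). Proof. by case: (p_density i). Qed.
Let p0 i x : 0 <= p i x. Proof. by case: (p_density i). Qed.

Let mm : measurable_fun setT m.
Proof. by apply: measurable_sum => i; exact: measurable_funM. Qed.
Let m0 x : 0 <= m x.
Proof. by apply: sumr_ge0 => i _; rewrite mulr_ge0 // ltW. Qed.
Let mEm : measurable_fun setT (EFin \o m). Proof. exact/measurable_EFinP. Qed.

Let N2 i j := [set x | 0 < p i x /\ p j x = 0].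

Let mN2 i j : measurable (N2 i j).
Proof.
have -> : N2 i j = [set x | 0 < p i x] `&` (p j @^-1` [set 0]) by [].
apply: measurableI.
  rewrite -[X in measurable X]setTI.
  have -> : [set x | 0 < p i x] = p i @^-1` `]0, +oo[%classic.
    by apply/seteqP; split => x /=; rewrite in_itv /= andbT.
  exact: mp.
by rewrite -[X in measurable X]setTI; exact: mp.
Qed.

(** On [N2 i j] the ratio [p i / p j] is infinite and the density [p i] is
    positive, yet the second moment of the ratio under that density is finite. *)
Let nuN2 i j : nu (N2 i j) = 0.
Proof.
apply/eqP; apply: contraT => nz.
have := moments i j i.
suff -> : (\int[nu]_x (((p i x)%:E / (p j x)%:E) ^+ 2 * (p i x)%:E) = +oo)%E
  by rewrite ltxx.
have Ny : (\int[nu]_(x in N2 i j) (cst +oo x) = +oo)%E.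
  by rewrite integral_cst // gt0_mulye // lt0e nz measure_ge0.
apply/eqP; rewrite -leye_eq -{1}Ny integral_mkcond.
apply: ge0_le_integralT => x; first by apply: erestrict_ge0 => ? _; exact: leey.
rewrite patchE; case: ifPn => [|_]; last first.
  by rewrite mule_ge0 ?lee_fin // expe2 mule_ge0 // mule_ge0 ?lee_fin // inve_ge0 lee_fin.
rewrite inE => -[pi0 pj0].
have -> : ((p i x)%:E / (p j x)%:E = +oo)%E
  by rewrite pj0 inver eqxx gt0_muley ?lte_fin.
by rewrite expe2 mulyy gt0_mulye ?lte_fin.
Qed.

(** Written with a product, which makes measurability immediate. *)
Let good (x : X) : bool := 0 < \prod_i p i x.

Let goodP x : reflect (forall i, 0 < p i x) (good x).
Proof.
apply: (iffP idP) => [h i|h]; last by apply: prodr_gt0.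
rewrite lt_neqAle p0 andbT; apply/eqP => e.
by move: h; rewrite /good (bigD1 i) //= -e mul0r ltxx.
Qed.

Let mgood : measurable_fun setT good.
Proof.
apply: measurable_fun_ltr => //; apply: measurable_prod => i _; exact: mp.
Qed.

(** Up to a null set, all components have the same support. *)
Let dichotomy : {ae nu, forall x, good x \/ forall i, p i x = 0}.
Proof.
have : {ae nu, forall x, forall i j, ~ N2 i j x}.
  apply: filter_forall => i; apply: filter_forall => j.
  by exists (N2 i j); split => // x /= /contrapT.
apply: filterS => x h; case: (boolP (good x)) => [|ng]; first by left.
right => i; apply/eqP; apply: contraT => pi.
case/negP: ng; apply/goodP => j; rewrite lt_neqAle p0 andbT eq_sym.
by apply/eqP => pj; apply: (h i j); split => //; rewrite lt_neqAle p0 andbT eq_sym.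
Qed.

Let good_m x : good x -> 0 < m x.
Proof.
move=> /goodP h; have [i _] := distribution_inhabited a_sum.
apply: (lt_le_trans (mulr_gt0 (a_gt0 i) (h i))).
by apply: (@le_sum_of_ge0 R I (fun i => a i * p i x)) => j; rewrite mulr_ge0 // ltW.
Qed.

Let bad_m x : (good x \/ forall i, p i x = 0) -> ~~ good x -> m x = 0.
Proof.
move=> [->//|h] _; rewrite /m /mixden big1 // => i _; by rewrite h mulr0.
Qed.

Let Y1 : {mfun Omega >-> X} :=
  HB.pack (Y 1%N) (isMeasurableFun.Build _ _ _ _ (Y 1%N) (mY (ltn0Sn 0))).
Let M : probability X R := distribution P Y1.

Let ME A : measurable A -> M A = (\int[nu]_(x in A) (m x)%:E)%E.
Proof. exact: (lawY (ltn0Sn 0)). Qed.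

Let intM (phi : X -> \bar R) :
  measurable_fun setT phi -> (forall x, 0 <= phi x)%E ->
  (\int[M]_x phi x = \int[nu]_x (phi x * (m x)%:E))%E.
Proof. by move=> mphi phi0; apply: ge0_integral_density. Qed.

Let mbad : measurable [set x | ~~ good x].
Proof.
rewrite -[X in measurable X]setTI (_ : [set x | _] = good @^-1` [set false]).
  exact: mgood.
by apply/seteqP; split => x /=; [move/negbTE|move=> ->].
Qed.

Let good_ae : {ae M, forall x, good x}.
Proof.
exists [set x | ~~ good x]; split => //; last by move=> x /negP.
rewrite ME // integral_mkcond.
transitivity (\int[nu]_x (cst 0%E x))%E; last by rewrite integral0.
apply: ge0_ae_eq_integral => //.
- by apply/(measurable_restrictT _ mbad); exact: measurable_funTS.
- by move=> x _; apply: erestrict_ge0 => ? _; rewrite lee_fin.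
- apply: filterS dichotomy => x dx _; rewrite patchE; case: ifPn => //.
  by rewrite inE /= => /(bad_m dx) ->.
Qed.

(** The value 1 off the good set, which is [M]-null, keeps the hypotheses of
    [discrete_rec_cvg] true at every point. *)
Let s i x : R := if good x then p i x / m x else 1.

Let s_gt0 i x : 0 < s i x.
Proof.
by rewrite /s; case: ifPn => // gx; rewrite divr_gt0 ?good_m //; exact/goodP.
Qed.

Let ms i : measurable_fun setT (s i).
Proof.
apply: measurable_fun_ifT => //; apply: measurable_funM => //.
exact: measurable_fun_inv.
Qed.

Let as_sum x : \sum_i a i * s i x = 1.
Proof.
rewrite /s; case: (boolP (good x)) => gx; last by under eq_bigr do rewrite mulr1.
under eq_bigr do rewrite mulrA.
by rewrite -mulr_suml -/(mixden p a x) -/m divff // gt_eqF // good_m.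
Qed.

Let s_int i : (\int[M]_x (s i x)%:E <= 1)%E.
Proof.
rewrite intM //; last 2 first.
- exact/measurable_EFinP.
- by move=> x; rewrite lee_fin ltW.
have [_ _ <-] := p_density i.
apply: ae_ge0_le_integral => //.
- by move=> x _; rewrite -EFinM lee_fin mulr_ge0 // ltW.
- by apply: emeasurable_funM => //; exact/measurable_EFinP.
- by move=> x _; rewrite lee_fin.
- exact/measurable_EFinP.
apply: filterS dichotomy => x dx _; rewrite -EFinM lee_fin /s.
case: ifPn => gx; first by rewrite divfK // gt_eqF // good_m.
by rewrite (bad_m dx gx) mulr0.
Qed.

Let second_moment i j l : (\int[nu]_x ((p i x / p j x) ^+ 2 * p l x)%:E < +oo)%E.
Proof.
apply: (le_lt_trans _ (moments i j l)); apply: ge0_le_integralT => x.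
  by rewrite lee_fin mulr_ge0 // sqr_ge0.
case: (eqVneq (p j x) 0) => pj; last first.
  by rewrite inver (negbTE pj) expe2 -!EFinM expr2.
have -> : (p i x / p j x) ^+ 2 * p l x = 0
  by rewrite pj invr0 mulr0 expr0n /= mul0r.
apply: mule_ge0; last by rewrite lee_fin.
by rewrite expe2; apply: mule_ge0; apply: mule_ge0; rewrite ?inve_ge0 ?lee_fin.
Qed.

Let s_sq i : (\int[M]_x ((s i x)^-1 ^+ 2)%:E < +oo)%E.
Proof.
have msi : measurable_fun setT (fun x => ((s i x)^-1 ^+ 2)%:E).
  apply/measurable_EFinP; apply: measurable_funX.
  by apply: measurable_fun_inv => // x; exact: ltW.
have mpp j l : measurable_fun setT (fun x => (((p j x / p i x) ^+ 2) * p l x)%:E).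
  apply/measurable_EFinP; apply: measurable_funM => //; apply: measurable_funX.
  by apply: measurable_funM => //; exact: measurable_fun_inv.
rewrite intM //; last by move=> x; rewrite lee_fin sqr_ge0.
apply: (@le_lt_trans _ _ (\int[nu]_x (\sum_j \sum_l
    #|I|%:R%:E * ((p j x / p i x) ^+ 2 * p l x)%:E))%E); last first.
  rewrite ge0_integral_sum //; last 2 first.
  - by move=> j; apply: emeasurable_sum => l; exact: emeasurable_funM.
  - move=> j x _; apply: sume_ge0 => l _.
    by rewrite mule_ge0 ?lee_fin // mulr_ge0 // sqr_ge0.
  apply: lte_sum_pinfty => j _.
  rewrite ge0_integral_sum //; last 2 first.
  - by move=> l; exact: emeasurable_funM.
  - by move=> l x _; rewrite mule_ge0 ?lee_fin // mulr_ge0 // sqr_ge0.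
  apply: lte_sum_pinfty => l _.
  rewrite ge0_integralZl_EFin //; last by move=> x _;
    rewrite lee_fin mulr_ge0 // sqr_ge0.
  by rewrite lte_mul_pinfty ?lee_fin.
apply: ae_ge0_le_integral => //.
- by move=> x _; rewrite -EFinM lee_fin mulr_ge0 // sqr_ge0.
- by apply: emeasurable_funM.
- move=> x _; apply: sume_ge0 => j _; apply: sume_ge0 => l _.
  by rewrite mule_ge0 ?lee_fin // mulr_ge0 // sqr_ge0.
- apply: emeasurable_sum => j; apply: emeasurable_sum => l; exact: emeasurable_funM.
apply: filterS dichotomy => x dx _.
under eq_bigr do under eq_bigr do rewrite -EFinM.
under eq_bigr do rewrite sumEFin.
rewrite sumEFin -EFinM lee_fin.
have F0 j l : 0 <= #|I|%:R * ((p j x / p i x) ^+ 2 * p l x).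
  by rewrite mulr_ge0 // mulr_ge0 // sqr_ge0.
case: (boolP (good x)) => gx; last first.
  by rewrite (bad_m dx gx) mulr0 sumr_ge0 // => j _; exact: sumr_ge0.
rewrite /s gx invf_div.
have mpi : (m x / p i x) ^+ 2 <= #|I|%:R * \sum_j (p j x / p i x) ^+ 2.
  apply: le_trans (sqr_sum_le (fun j => p j x / p i x)).
  rewrite lerXn2r ?nnegrE ?divr_ge0 //.
    by apply: sumr_ge0 => j _; rewrite divr_ge0.
  rewrite -mulr_suml ler_wpM2r ?invr_ge0 //; apply: ler_sum => j _.
  by rewrite ler_piMl // (a_le1 a_gt0 a_sum).
have mle : m x <= \sum_l p l x.
  by apply: ler_sum => j _; rewrite ler_piMl // (a_le1 a_gt0 a_sum).
apply: (le_trans (ler_pM (sqr_ge0 _) (m0 x) mpi mle)).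
rewrite mulr_sumr big_distrlr /=; apply: ler_sum => j _; apply: ler_sum => l _.
by rewrite -[leLHS]mulrA.
Qed.

Let mqt i n (t : i.-tuple X) : (1 <= i)%N -> (1 <= n)%N ->
  measurable_fun setT (fun x => q n t x / m x).
Proof.
move=> i1 n1; have [mq _ _] := condY i1 n1.
apply: measurable_funM; last exact: measurable_fun_inv.
exact: (measurableT_comp mq (measurable_fun_pair (measurable_cst t) (@measurable_id _ X setT))).
Qed.

Let kap i n (t : i.-tuple X) x := q n t x / m x.

Let law n : (1 <= n)%N -> forall A, measurable A -> P (Y n @^-1` A) = M A.
Proof. by move=> n1 A mA; rewrite ME //; exact: lawY. Qed.

Let mm0 : measurable [set x | m x != 0].
Proof.
rewrite -[X in measurable X]setTI (_ : [set x | _] = m @^-1` (~` [set 0])).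
  by apply: mm => //; exact: measurableC.
by apply/seteqP; split => x /= /eqP.
Qed.

Let condM i n : (1 <= i)%N -> (1 <= n)%N ->
  is_cond_density P M (history Y i) (Y (i + n)%N) (@kap i n).
Proof.
move=> i1 n1; have [mq q0 rect] := condY i1 n1.
have in1 : (1 <= i + n)%N by rewrite (leq_trans i1) // leq_addr.
split.
- apply: measurable_funM => //; apply: measurable_fun_inv => //.
  exact: (measurableT_comp mm measurable_snd).
- by move=> t x; rewrite divr_ge0.
move=> A B mA mB.
have mB' : measurable (B `&` [set x | m x != 0]) by exact: measurableI.
(* Where [m] vanishes the quotient [q / m] loses the mass of [q]; but the
   observations almost surely avoid that set. *)
transitivity (P (history Y i @^-1` A `&` Y (i + n)%N @^-1` (B `&` [set x | m x != 0]))).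
  have mHA : measurable (history Y i @^-1` A).
    rewrite -[X in measurable X]setTI.
    suff mh : measurable_fun setT (history Y i) by exact: mh.
    apply/measurable_fun_tnthP => j.
    rewrite (_ : _ \o _ = Y j.+1); first exact: mY.
    by apply/funext => omega /=; rewrite tnth_mktuple.
  have mYB C : measurable C -> measurable (Y (i + n)%N @^-1` C).
    by move=> mC; rewrite -[X in measurable X]setTI; exact: (mY in1).
  rewrite preimage_setI setIA.
  set E := _ `&` Y (i + n)%N @^-1` B; set F := Y (i + n)%N @^-1` [set x | m x != 0].
  have mE : measurable E by apply: measurableI; [exact: mHA|exact: mYB].
  have mF : measurable F by exact: mYB.
  apply: (eq_trans (measureDI P mE mF)); rewrite -[RHS]add0e; congr (_ + _)%E.
  apply: (@subset_measure0 _ _ _ _ _ (Y (i + n)%N @^-1` (~` [set x | m x != 0]))).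
  - exact: measurableD.
  - by apply: mYB; exact: measurableC.
  - by move=> omega [_ nF].
  apply: (eq_trans (lawY in1 (measurableC mm0))).
  apply: integral0_eq => x /= /negP; rewrite negbK => /eqP ->//.
rewrite rect //; apply: eq_integral => omega _.
rewrite [RHS]integral_mkcond intM; last 2 first.
- apply/(measurable_restrictT _ mB); apply: measurable_funTS;
    apply/measurable_EFinP.
  exact: mqt.
- by move=> x; apply: erestrict_ge0 => ? _; rewrite lee_fin divr_ge0.
rewrite integral_mkcond; apply: eq_integral => x _.
rewrite !patchE in_setI; case: (x \in B) => //=; last by rewrite mul0e.
case: ifPn; rewrite ?inE ?notin_setE /=; last first.
  by move=> /negP; rewrite negbK => /eqP ->; rewrite mule0.
by move=> mx; rewrite -EFinM divfK.
Qed.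

Let depM i n : (1 <= i)%N -> (1 <= n)%N ->
  (\int[P]_omega \int[M]_x ((kap n (history Y i omega) x - 1) ^+ 2)%:E
   <= (c0 ^+ 2 * rho ^+ (2 * n))%:E)%E.
Proof.
move=> i1 n1; have [mq q0 _] := condY i1 n1.
apply: le_trans (depY n1).
apply: ereal_sup_ubound; exists i => //.
apply: eq_integral => omega _; rewrite intM.
- by apply: eq_integral => x _; rewrite -EFinM.
- apply/measurable_EFinP; apply: measurable_funX; apply: measurable_funB => //.
  exact: mqt.
- by move=> x; rewrite lee_fin sqr_ge0.
Qed.

Let mixden_good h x : good x -> mixden s h x = mixden p h x / m x.
Proof.
move=> gx; rewrite /mixden mulr_suml; apply: eq_bigr => i _.
by rewrite /s gx mulrA.
Qed.

Let identM h : distribution_on h -> {ae M, forall x, mixden s h x = 1} -> h = a.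
Proof.
move=> hd [N [mN MN0 hN]]; apply: ident => //.
have mnull : {ae nu, forall x, N x -> m x = 0}.
  have : (\int[nu]_(x in N) `|(m x)%:E| = 0)%E.
    under eq_integral do rewrite gee0_abs ?lee_fin //.
    by rewrite -ME.
  move/(ae_eq_integral_abs nu mN (measurable_funTS mEm)).
  by apply: filterS => x h' Nx; have := h' Nx; case.
apply: filterS2 dichotomy mnull => x dx Nx.
case: (boolP (good x)) => gx; last first.
  rewrite (bad_m dx gx); case: dx gx => [->//|p00] _.
  by rewrite /mixden big1 // => i _; rewrite p00 mulr0.
have mx := good_m gx.
have : mixden s h x = 1.
  by apply: contrapT => e; move: mx; rewrite Nx ?ltxx //; exact: hN.
by rewrite mixden_good // => /(congr1 (fun t => t * m x));
  rewrite divfK ?gt_eqF // mul1r.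
Qed.

Let rec_good omega n : (forall j, (1 <= j)%N -> good (Y j omega)) ->
  discrete_rec p w g0 (Y ^~ omega) n = discrete_rec s w g0 (Y ^~ omega) n.
Proof.
move=> h; elim: n => //= n ->; apply/funext => i.
have gx := h n.+1 isT; congr (_ + _ * _).
rewrite mixden_good // /s gx.
have mx := good_m gx.
by rewrite invf_div mulrACA [_ / m _ * _]mulrAC -!mulrA; congr (_ * _);
  rewrite mulrCA !mulrA mulVf ?gt_eqF // mul1r mulrC.
Qed.

(** Dividing all component densities by [m] leaves the update unchanged, so
    the recursions for [p] and for [s] agree on the trajectories that stay in
    the good set, which are almost all of them. *)
Theorem mixture_rec_cvg :
  {ae P, forall omega, forall i,
     discrete_rec p w g0 (Y ^~ omega) n i @[n --> \oo] --> a i}.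
Proof.
have cv := discrete_rec_cvg ms s_gt0 a_gt0 a_sum as_sum g0_gt0 g0_sum wP mY law
  condM rho01 depM s_int s_sq identM.
have gd : {ae P, forall omega, forall j, (1 <= j)%N -> good (Y j omega)}.
  have [N [mN N0 Nb]] := good_ae.
  have : P.-negligible (\bigcup_j (Y j.+1 @^-1` N)).
    apply: negligible_bigcup => j; exists (Y j.+1 @^-1` N); split => //.
      by rewrite -[X in measurable X]setTI; exact: (mY (ltn0Sn j)).
    exact: (eq_trans (law (ltn0Sn j) mN)).
  apply: negligibleS => omega /=;
    rewrite -existsNE => -[[|j] /not_implyP[//= _ bj]].
  by exists j => //=; apply: Nb.
apply: filterS2 cv gd => omega h g i.
by under eq_fun do rewrite rec_good //; exact: h.
Qed.
End Mixture.

(** * Mixing densities with finite support *)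

Section FiniteSupport.
Context (R : realType) (d : measure_display) (T : measurableType d).
Variables (mu : {measure set T -> \bar R}) (A : {fset T}).
Hypothesis mset1 : forall t : T, measurable [set t].

Lemma finite_support_indic (h : T -> R) t :
  (forall t, t \notin A -> h t = 0) -> h t = \sum_(u <- A) h u * \1_[set u] t.
Proof.
move=> hA.
have ind u : \1_[set u] t = (t == u)%:R :> R.
  by rewrite indicE; congr (nat_of_bool _)%:R; apply/idP/eqP => [|->]; rewrite inE.
case: (boolP (t \in A)) => tA.
  rewrite (big_rem t) //= ind eqxx mulr1 big_seq big1 ?addr0 // => u.
  rewrite mem_rem_uniq ?fset_uniq // inE => /andP[ut _].
  by rewrite ind eq_sym (negbTE ut) mulr0.
rewrite hA // big_seq big1 // => u uA.
by rewrite ind; case: eqVneq uA tA => [<- ->//|_ _ _]; rewrite mulr0.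
Qed.

Lemma integral_finite_support (h : T -> R) :
  (forall t, 0 <= h t) -> (forall t, t \notin A -> h t = 0) ->
  (\int[mu]_t (h t)%:E = \sum_(t <- A) (h t)%:E * mu [set t])%E.
Proof.
move=> h0 hA.
have hE t : ((h t)%:E = \sum_(u <- A) (h u)%:E * (\1_[set u] t)%:E)%E.
  by rewrite {1}(finite_support_indic t hA) -sumEFin; apply: eq_bigr => u _;
    rewrite EFinM.
under eq_integral do rewrite hE.
rewrite ge0_integral_sum //; last 2 first.
- by move=> u; apply: emeasurable_funM => //; exact/measurable_EFinP.
- by move=> u x _; rewrite mule_ge0 ?lee_fin.
apply: eq_bigr => u _; rewrite ge0_integralZl_EFin //; last exact/measurable_EFinP.
by rewrite integral_indic // setIT.
Qed.

Lemma measurable_finite_support (h : T -> R) :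
  (forall t, t \notin A -> h t = 0) -> measurable_fun setT h.
Proof.
move=> hA.
rewrite (_ : h = fun t => \sum_(u <- A) h u * \1_[set u] t).
  by apply: measurable_sum => u; exact: measurable_funM.
by apply/funext => t; exact: finite_support_indic.
Qed.

End FiniteSupport.

Section PredictiveRecursionReduction.
Context (R : realType) (dX dT dO : measure_display) (X : measurableType dX)
  (T : measurableType dT) (Omega : measurableType dO).
Variables (nu : {measure set X -> \bar R}) (mu : {measure set T -> \bar R})
  (P : probability Omega R).
Variables (Theta That : set T) (p : X -> T -> R) (f f0 : T -> R) (w : nat -> R)
  (Y : nat -> Omega -> X) (q : forall i : nat, nat -> i.-tuple X -> X -> R)
  (c0 rho : R).
Hypothesis mset1 : forall t : T, measurable [set t].
Hypothesis finTheta : finite_set Theta.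
Hypothesis Theta_That : Theta `<=` That.
Hypothesis p_density : forall th, That th -> is_density nu (p ^~ th).
Hypothesis f_density : is_density mu f.
Hypothesis f_supp : dsupport f = Theta.
Hypothesis f0_density : is_density mu f0.
Hypothesis f0_supp : dsupport f0 = Theta.
Let m := mixture mu p Theta f.
Hypothesis ident : identifiable mu nu p Theta f.
Hypothesis mY : forall i, (1 <= i)%N -> measurable_fun setT (Y i).
Hypothesis lawY : forall i, (1 <= i)%N -> has_density P nu (Y i) m.
Hypothesis condY : forall i n, (1 <= i)%N -> (1 <= n)%N ->
  is_cond_density P nu (history Y i) (Y (i + n)%N) (@q i n).
Hypothesis rho01 : 0 < rho < 1.
Hypothesis depY : geometric_dependence P nu Y m q c0 rho.
Hypothesis wP : weights w.
Hypothesis moments : ratio_second_moment nu p That.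

(** Densities on [Theta] correspond to the vectors of their masses at the
    points of positive [mu]-mass. This turns mixtures into finite sums,
    predictive recursion into [discrete_rec], and identifiability into
    uniqueness of the vector. The remaining points of [Theta] form a
    [mu]-null set, and off [Theta] every iterate vanishes. *)
Theorem pred_rec_cvg :
  {ae P, forall omega, {ae mu, forall th,
     pred_rec mu p w f0 (Y ^~ omega) n th @[n --> \oo] --> f th}}.
Proof.
have [A AE] := finite_fsetP.1 finTheta.
have inA t : (t \in A) = (t \in Theta) by rewrite AE; apply/idP/idP; rewrite inE.
have w01 : forall n, (1 <= n)%N -> 0 < w n <= 1 by case: wP.
have [mf fge0 f1] := f_density.
have [mf0 f0ge0 f01] := f0_density.
have fA t : t \notin A -> f t = 0.
  move=> tA; apply/eqP; apply: contraNT tA => ft.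
  by rewrite inA inE -f_supp.
have f0A t : t \notin A -> f0 t = 0.
  move=> tA; apply/eqP; apply: contraNT tA => ft.
  by rewrite inA inE -f0_supp.
have fpos t : t \in A -> 0 < f t.
  rewrite inA inE -f_supp /dsupport /= => ft.
  by rewrite lt_neqAle fge0 andbT eq_sym.
have f0pos t : t \in A -> 0 < f0 t.
  rewrite inA inE -f0_supp /dsupport /= => ft.
  by rewrite lt_neqAle f0ge0 andbT eq_sym.
have pge0 x t : t \in A -> 0 <= p x t.
  by rewrite inA inE => /Theta_That /p_density[].
have mass_fin t : t \in A -> mu [set t] \is a fin_num.
  move=> tA; rewrite ge0_fin_numE //.
  have : ((f t)%:E * mu [set t] < +oo)%E.
    apply: (@le_lt_trans _ _ 1%E); last exact: ltry.
    rewrite -f1 (integral_finite_support mu mset1 fge0 fA) (big_rem t) //=.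
    by rewrite leeDl // sume_ge0 // => u _; rewrite mule_ge0 ?lee_fin.
  by rewrite !ltey; apply: contraNN => /eqP ->; rewrite gt0_muley ?lte_fin ?fpos.
pose mass t := fine (mu [set t]).
have mass_ge0 t : 0 <= mass t by exact: fine_ge0.
pose B := [fset t in A | mass t != 0]%fset.
have BA t : t \in B -> t \in A by rewrite !inE => /andP[].
have massB (i : B) : 0 < mass (val i).
  rewrite lt_neqAle mass_ge0 andbT eq_sym.
  by have := valP i; rewrite !inE => /andP[].
have intB (h : T -> R) :
  (forall t, t \in A -> 0 <= h t) -> (forall t, t \notin A -> h t = 0) ->
    (\int[mu]_t (h t)%:E = (\sum_(i : B) h (val i) * mass (val i))%:E)%E.
  move=> hge hA.
  have h0 t : 0 <= h t by case: (boolP (t \in A)) => [/hge//|/hA ->].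
  rewrite (integral_finite_support mu mset1 h0 hA).
  rewrite big_seq (eq_bigr (fun t => (h t * mass t)%:E)); last first.
    by move=> t tA; rewrite EFinM fineK // mass_fin.
  rewrite -big_seq sumEFin; congr _%:E.
  rewrite (bigID (fun t => mass t != 0)) /= [X in _ + X]big1 ?addr0; last first.
    by move=> t; rewrite negbK => /eqP ->; rewrite mulr0.
  by rewrite big_fset_condE big_seq_fsetE.
pose pI (i : B) x := p x (val i).
pose at_atoms (h : T -> R) (i : B) := h (val i) * mass (val i).
have mixE h x : (forall t, t \in A -> 0 <= h t) -> (forall t, t \notin A -> h t = 0) ->
    mixture mu p setT h x = mixden pI (at_atoms h) x.
  move=> hge hA; rewrite /mixture /Rintegral intB /=.
  - by apply: eq_bigr => i _; rewrite /at_atoms /pI -mulrA mulrC.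
  - by move=> t tA; rewrite mulr_ge0 ?hge ?pge0.
  - by move=> t /hA ->; rewrite mulr0.
have mixTheta h x : (forall t, t \notin A -> h t = 0) ->
    mixture mu p Theta h x = mixture mu p setT h x.
  move=> hA; rewrite /mixture /Rintegral integral_mkcond; congr fine.
  apply: eq_integral => t _; rewrite patchE -inA; case: ifPn => // /hA ->.
  by rewrite mulr0.
have fge t : t \in A -> 0 <= f t by [].
have f0ge t : t \in A -> 0 <= f0 t by [].
have sumB (h : T -> R) : is_density mu h -> (forall t, t \notin A -> h t = 0) ->
    \sum_i at_atoms h i = 1.
  move=> [_ hge h1] hA; apply: EFin_inj; rewrite -h1 intB //.
have mE : m = mixden pI (at_atoms f).
  by apply/funext => x; rewrite /m mixTheta // mixE.
have recE omega n : let g := pred_rec mu p w f0 (Y ^~ omega) n in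
    [/\ forall t, t \in A -> 0 <= g t, forall t, t \notin A -> g t = 0 &
        at_atoms g = discrete_rec pI w (at_atoms f0) (Y ^~ omega) n].
  elim: n => [|n [IH1 IH2 IH3]] /=; first by split.
  have /andP[w0 w1] := w01 n.+1 isT.
  set g := pred_rec mu p w f0 (Y ^~ omega) n in IH1 IH2 IH3 *.
  split=> [t tA|t tA|].
  - rewrite addr_ge0 // mulr_ge0 ?IH1 ?subr_ge0 // ?(ltW w0) //.
    rewrite divr_ge0 // ?mulr_ge0 ?pge0 ?IH1 // fine_ge0 // integral_ge0 // => u _.
    rewrite lee_fin; case: (boolP (u \in A)) => [uA|/IH2 ->]; last by rewrite mulr0.
    by rewrite mulr_ge0 ?pge0 ?IH1.
  - by rewrite IH2 // !mulr0 mul0r mulr0 addr0.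
  - apply/funext => i; rewrite -IH3 /bayes_step -mixE // /at_atoms /pI.
    by rewrite !mulrA mulrDl; congr (_ + _); rewrite -!mulrA;
      congr (_ * (_ * (_ * _))); rewrite mulrC.
have B_That (i : B) : That (val i).
  by apply: Theta_That; have := BA _ (valP i); rewrite inA inE.
have lawB n : (1 <= n)%N -> has_density P nu (Y n) (mixden pI (at_atoms f)).
  by rewrite -mE; exact: lawY.
have depB : geometric_dependence P nu Y (mixden pI (at_atoms f)) q c0 rho.
  by rewrite -mE.
have momB (i j l : B) :
    (\int[nu]_x (((pI i x)%:E / (pI j x)%:E) ^+ 2 * (pI l x)%:E) < +oo)%E.
  have [b bP] := moments; apply: le_lt_trans (lt_trans bP (ltry b)).
  by apply: ereal_sup_ubound; exists (val i), (val j), (val l).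
have identB h : distribution_on h ->
    {ae nu, forall x, mixden pI h x = mixden pI (at_atoms f) x} -> h = at_atoms f.
  move=> [h0 h1] hm.
  pose g t := if (insub t : option B) is Some i then h i / mass t else 0.
  have gB (i : B) : g (val i) = h i / mass (val i) by rewrite /g valK.
  have gnB t : t \notin B -> g t = 0 by move=> tB; rewrite /g insubN.
  have gA t : t \notin A -> g t = 0.
    by move=> tA; apply: gnB; apply: contra tA; exact: BA.
  have g0 t : 0 <= g t.
    by rewrite /g; case: insubP => // i _ _; rewrite divr_ge0.
  have gh : at_atoms g = h.
    by apply/funext => i; rewrite /at_atoms gB divfK // gt_eqF.
  have gd : is_density mu g.
    split=> //; first exact: measurable_finite_support gA.
    rewrite intB //; apply: (congr1 EFin).
    by transitivity (\sum_i h i) => //; rewrite -gh.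
  have gs : dsupport g `<=` Theta.
    move=> t gt; rewrite /dsupport /= in gt; have : t \in A.
      by apply: contraNT gt => /gA ->.
    by rewrite inA inE.
  have [|N [mN N0 Nfg]] := ident gd gs.
    apply: filterS hm => x hx; rewrite mixTheta // mixE // gh hx.
    by rewrite -mE.
  apply/funext => i; rewrite -gh /at_atoms; congr (_ * _).
  apply: contrapT => gf; have := massB i; rewrite /mass.
  suff -> : mu [set val i] = 0%E by rewrite ltxx.
  by apply: (subset_measure0 _ mN _ N0) => // t ->; exact: Nfg.
have f_gt0 i : 0 < at_atoms f i by rewrite mulr_gt0 // fpos // BA //; exact: valP.
have f0_gt0 i : 0 < at_atoms f0 i by rewrite mulr_gt0 // f0pos // BA //;
  exact: valP.
have := mixture_rec_cvg (fun i => p_density (B_That i)) f_gt0 (sumB _ f_density fA)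
  f0_gt0 (sumB _ f0_density f0A) wP mY lawB condY rho01 depB momB identB.
apply: filterS => omega cv.
(* Convergence may fail only on the [mu]-null part [N0] of [Theta]. *)
pose ind0 t : R := if (t \in A) && (mass t == 0) then 1 else 0.
have ind0A t : t \notin A -> ind0 t = 0 by rewrite /ind0 => /negbTE ->.
pose N0 := [set t | (t \in A) && (mass t == 0)].
have mN0 : measurable N0.
  have -> : N0 = ind0 @^-1` [set 1].
    apply/seteqP; split => t; rewrite /N0 /ind0 /=; case: ifP => // _ /eqP.
    by rewrite eq_sym oner_eq0.
  rewrite -[X in measurable X]setTI.
  by apply: (measurable_finite_support mset1 ind0A).
exists N0; split => //.
  transitivity (\int[mu]_t (ind0 t)%:E)%E.
    rewrite -[N0 in LHS]setIT -integral_indic //; apply: eq_integral => t _.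
    rewrite indicE /ind0; congr (_%:E); rewrite /N0.
    by case: ifP => ht; [rewrite mem_set|rewrite memNset //= ht].
  rewrite (integral_finite_support mu mset1 _ ind0A); last by move=> t;
    rewrite /ind0; case: ifP.
  rewrite big_seq big1 // => t tA; rewrite /ind0; case: ifP => [/andP[_ /eqP mt]|_].
    by rewrite -(fineK (mass_fin t tA)) -/(mass t) mt mule0.
  by rewrite mul0e.
move=> t; apply: contra_notP => tN0 /=.
  case: (boolP (t \in A)) => tA; last first.
    apply: cvg_near_cst; near=> n; have [_ gA _] := recE omega n.
    by rewrite gA // fA.
  have mt : mass t != 0 by apply: contra_notN tN0 => mt; rewrite /N0 /= tA.
  have tB : t \in B by rewrite !inE tA.
  have := cvgM (cv [` tB]%fset) (cvg_cst (mass t)^-1).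
  rewrite /at_atoms /= mulfK // => cvt.
  suff -> : (fun n => pred_rec mu p w f0 (Y ^~ omega) n t) =
    (fun n => discrete_rec pI w (at_atoms f0) (Y ^~ omega) n [` tB]%fset * (mass t)^-1).
    exact: cvt.
  apply/funext => n; have [_ _ gE] := recE omega n.
  by rewrite -gE /at_atoms /= mulfK.
Unshelve. all: by end_near.
Qed.

End PredictiveRecursionReduction.

Theorem theorem3p1 (R : realType) (k : nat) (chi : ptopologicalType)
    (nu : {sigma_finite_measure set (borel chi) -> \bar R})
    (mu : {sigma_finite_measure set (borel 'rV[R]_k) -> \bar R})
    (Theta That : set 'rV[R]_k)
    (p : borel chi -> borel 'rV[R]_k -> R)
    (f f0 : borel 'rV[R]_k -> R)
    (w : nat -> R)
    (d : measure_display) (Omega : measurableType d) (P : probability Omega R)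
    (X : nat -> Omega -> borel chi)
    (q : forall i : nat, nat -> i.-tuple (borel chi) -> borel chi -> R)
    (c0 rho : R)
    (ThetaH : set 'rV[R]_k) (chic : set chi) :
  finite_set Theta ->
  Theta `<=` That ->
  closed That ->
  convex_set (That : set (convex_lmodType 'rV[R]_k)) ->
  (forall th, That th -> is_density nu (p ^~ th)) ->
  is_density mu f ->
  dsupport f = Theta ->
  is_density mu f0 ->
  dsupport f0 = Theta ->
  let m := mixture mu p Theta f in
  identifiable mu nu p Theta f ->
  KL mu f f0 \is a fin_num ->
  KL nu m (mixture mu p setT f0) \is a fin_num ->
  (forall i, (1 <= i)%N -> measurable_fun setT (X i)) ->
  (forall i, (1 <= i)%N -> has_density P nu (X i) m) ->
  (forall i n, (1 <= i)%N -> (1 <= n)%N ->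
     is_cond_density P nu (history X i) (X (i + n)%N) (@q i n)) ->
  0 < c0 ->
  0 < rho < 1 ->
  geometric_dependence P nu X m q c0 rho ->
  weights w ->
  product_moments P X p That ->
  ratio_second_moment nu p That ->
  kernel_bounded_continuous (T := 'rV[R]_k) p That ->
  finite_set ThetaH ->
  ThetaH `<=` That ->
  compact chic ->
  ratio_dominated p Theta ThetaH chic ->
  kernel_bounded_below p Theta chic ->
  kernel_bounded_above p Theta chic ->
  {ae P, forall omega, {ae mu, forall th,
     pred_rec mu p w f0 (X ^~ omega) n th @[n --> \oo] --> f th}}.
Proof.
move=> finT TT _ _ pd fd fs f0d f0s m id _ _ mX law cond _ rho01 dep wP _ mom _ _ _ _ _ _ _.
have mset1 (t : borel 'rV[R]_k) : measurable [set t].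
  rewrite -[X in measurable X]setCK; apply: measurableC.
  apply: sub_sigma_algebra; apply: closed_openC.
  exact: (@accessible_closed_set1 'rV[R]_k (hausdorff_accessible (@norm_hausdorff R 'rV[R]_k))).
exact: (pred_rec_cvg mset1 finT TT pd fd fs f0d f0s id mX law cond rho01 dep wP mom).
Qed.
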